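(* Fix $r \geq 2$ and let $\mathbf H_n = (H_n^{(1)}, H_n^{(2)}) \sim \mathbf H_r(n, p, \rho)$ with parameters $p = p_n \in (0,1)$ and $\rho = \rho_n \in [0, p(1-p))$. Given $\mathbf H_n$, suppose the vertices of $\mathbf H_n$ are colored uniformly at random with $c_n$ colors such that, with $p_{1,2} := \rho + p^2$, $$\mathbb{E}\, T(H_n^{(1)}) = \mathbb{E}\, T(H_n^{(2)}) = \frac{\binom{n}{r}p}{c_n^{r-1}} \to \lambda \quad\text{and}\quad \frac{\mathbb{E}\,|E(H_n^{(1)}) \cap E(H_n^{(2)})|}{c_n^{r-1}} = \frac{\binom{n}{r} p_{1,2}}{c_n^{r-1}} \to \lambda_{1,2},$$ for constants $0 \leq \lambda_{1,2} < \lambda$. Then, for $p \gg n^{-r}$ (that is, $p_n n^r\to\infty$), as $n\to\infty$ the vector $(T(H_n^{(1)}),T(H_n^{(2)}))^\top$ converges in distribution to $$\begin{pmatrix} Z_1 + Z_{1,2} \\ Z_2 + Z_{1,2} \end{pmatrix},$$ where $Z_1 \sim \mathrm{Pois}(\lambda - \lambda_{1,2})$, $Z_2 \sim \mathrm{Pois}(\lambda - \lambda_{1,2})$, and $Z_{1,2} \sim \mathrm{Pois}(\lambda_{1,2})$ are independent.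
   Context: The correlated Erdős–Rényi random hypergraph model $\mathbf H_r(n,p,\rho)$ is a random pair $(H_n^{(1)},H_n^{(2)})$ of $r$-uniform hypergraphs with common vertex set $[n]=\{1,\dots,n\}$ such that, independently over all $r$-element subsets $e$ of $[n]$, $\mathbb P(e\in E(H_n^{(1)}))=\mathbb P(e\in E(H_n^{(2)}))=p$ and $\mathbb P(e\in E(H_n^{(1)}),\, e\in E(H_n^{(2)}))=\rho+p^2$. ''Colored uniformly at random with $c_n$ colors'' means each vertex $v\in[n]$ gets a color $X_v$ uniform on $\{1,\dots,c_n\}$, independently over the vertices and independently of $\mathbf H_n$ (a single coloring is used for both layers). $T(H_n^{(i)})=\sum_{e\in E(H_n^{(i)})}\mathbf 1\{X_v=X_{v'}\ \forall v,v'\in e\}$ is the number of monochromatic hyperedges. $\mathrm{Pois}(0)$ is the point mass at $0$. *)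

(* Defs.v *)
From HB Require Import structures.
From mathcomp Require Import all_boot all_order all_algebra.
From mathcomp Require Import all_classical all_reals all_analysis.

Set Implicit Arguments.
Unset Strict Implicit.
Unset Printing Implicit Defensive.

Import Order.TTheory GRing.Theory Num.Theory.
Import numFieldNormedType.Exports.

Local Open Scope classical_set_scope.
Local Open Scope ring_scope.

Definition edge (r n : nat) : finType := {e : {set 'I_n} | #|e| == r}.

(* An r-uniform hypergraph on the vertex set 'I_n is identified with its set
   of hyperedges. *)
Definition hypergraph (r n : nat) : finType := {set edge r n}.

Definition coloring (n c : nat) : finType := {ffun 'I_n -> 'I_c}.

Definition monochromatic (r n c : nat) (x : coloring n c) (e : edge r n) : bool :=
  [forall v in val e, forall v' in val e, x v == x v'].

Definition mono_count (r n c : nat) (H : hypergraph r n) (x : coloring n c) :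
  nat := (\sum_(e in H) monochromatic x e)%N.

(* The next three notions are meant for a countable S carrying the sigma-algebra
   of all its subsets, so that A below ranges over arbitrary sets. *)
Definition discrete_random_element d (T : measurableType d) (S : Type)
    (Y : T -> S) : Prop :=
  forall A : set S, measurable (Y @^-1` A).

Definition independent_pair d (T : measurableType d) (R : realType)
    (P : probability T R) (S S' : Type) (Y : T -> S) (Y' : T -> S') : Prop :=
  forall (A : set S) (A' : set S'),
    P (Y @^-1` A `&` Y' @^-1` A') = (P (Y @^-1` A) * P (Y' @^-1` A'))%E.

Definition mutually_independent d (T : measurableType d) (R : realType)
    (P : probability T R) (I : finType) (S : Type) (Y : I -> T -> S) : Prop :=
  forall (J : {set I}) (A : I -> set S),
    P (\bigcap_(i in [set` J]) (Y i @^-1` A i)) =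
    (\prod_(i in J) P (Y i @^-1` A i))%E.

Record correlated_ER d (T : measurableType d) (R : realType)
    (P : probability T R) (r n : nat) (p rho : R)
    (H1 H2 : T -> hypergraph r n) : Prop := CorrelatedER {
  cER_random : discrete_random_element (fun w => (H1 w, H2 w));
  cER_indep :
    mutually_independent P (fun (e : edge r n) w => (e \in H1 w, e \in H2 w));
  cER_edge1 : forall e : edge r n, P [set w | e \in H1 w] = p%:E;
  cER_edge2 : forall e : edge r n, P [set w | e \in H2 w] = p%:E;
  cER_edge12 : forall e : edge r n,
    P [set w | e \in H1 w /\ e \in H2 w] = (rho + p ^+ 2)%:E }.

Record uniform_coloring d (T : measurableType d) (R : realType)
    (P : probability T R) (n c : nat) (X : T -> coloring n c) : Prop :=
    UniformColoring {
  ucol_random : discrete_random_element X;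
  ucol_indep : mutually_independent P (fun (v : 'I_n) w => X w v);
  ucol_unif : forall (v : 'I_n) (k : 'I_c),
    P [set w | X w v = k] = (c%:R^-1)%:E }.

(* Weak convergence; the Y n and Y may live on different probability spaces. *)
Definition cvg_in_distribution (R : realType) (V : topologicalType)
    (d : nat -> measure_display) (T : forall n, measurableType (d n))
    (P : forall n, probability (T n) R) (Y : forall n, T n -> V)
    (d' : measure_display) (T' : measurableType d')
    (P' : probability T' R) (Y' : T' -> V) : Prop :=
  forall f : V -> R, continuous f -> (exists M : R, forall x, `|f x| <= M) ->
    (fun n => 'E_(P n)[f \o Y n])%E @ \oo --> ('E_P'[f \o Y'])%E.

(* The second argument of poisson_prob is a dummy; for a rate equal to 0,
   poisson_prob is the point mass at 0. *)
Definition poisson_distributed d (T : measurableType d) (R : realType)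
    (P : probability T R) (Z : T -> nat) (rate : R) : Prop :=
  forall A : set nat, P (Z @^-1` A) = poisson_prob rate 0%N A.

(* Main.v *)
Require Import Defs.
From HB Require Import structures.
From mathcomp Require Import all_boot all_order all_algebra.
From mathcomp Require Import all_classical all_reals all_analysis.
From mathcomp Require Import ring lra.

Set Implicit Arguments.
Unset Strict Implicit.
Unset Printing Implicit Defensive.

Import Order.TTheory GRing.Theory Num.Theory.
Import numFieldNormedType.Exports.

Local Open Scope classical_set_scope.
Local Open Scope ring_scope.

(** Why the theorem holds.  Given the colouring, each monochromatic [r]-set is
    an edge of both layers with probability [p12 = rho + p ^ 2], of exactly one given
    layer with probability [p - p12], independently of the others.  So the joint
    generating function of [(T1, T2)] at [(s, t)] is the average over colourings of
    [(1 - th) ^ M], where [M] is the number of monochromatic [r]-sets and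
    [th = p12 (1 - s t) + (p - p12) (1 - s) + (p - p12) (1 - t)]
    ([mono_counts_pgf]).  The correlated two-layer problem is thereby reduced to one
    dependent sum, [M], which involves neither [p] nor [rho].

    The indicators summed in [M] are locally dependent: the event that [e] is
    monochromatic is independent of the colours outside [e].  A Stein-Chen argument
    on the generating function ([stein_chen_pgf]) bounds the distance from the
    average to [exp (- th * E M)] by [th ^ 2] times a sum over pairs of meeting
    edges ([mono_count_pgf]).  It involves only second moments of [M], and it
    covers the case where [p] stays bounded away from 0, in which [M] itself
    remains random in the limit.  The bound tends to 0 ([stein_chen_error_cvg0]) because
    [c] tends to infinity ([colors_cvg_pinfty]), while [th * E M] tends to
    [lambda12 (1 - s t) + (lambda - lambda12) (1 - s) + (lambda - lambda12) (1 - t)],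
    minus the exponent of the generating function of [(Z1 + Z12, Z2 + Z12)]
    ([poisson_sums_pgf]).  Convergence of generating functions on [[0, 1)] squared
    implies convergence in law on pairs of natural numbers
    ([cvg_mean_of_cvg_pgf]). *)

(** * The Stein-Chen bound for generating functions *)

Lemma exprB_bernoulli (R : realFieldType) (u : R) (a k : nat) :
  0 <= u <= 1 -> 0 <= u ^+ a - u ^+ (a + k) <= (1 - u) * k%:R.
Proof.
move=> /andP[u0 u1].
have ua b : 0 <= u ^+ b <= 1 by rewrite exprn_ge0//= exprn_ile1.
elim: k => [|k /andP[IH1 IH2]]; first by rewrite addn0 subrr mulr0 lexx.
rewrite addnS exprSr -natr1 mulrDr mulr1.
have /andP[h0 h1] := ua (a + k)%N.
by apply/andP; split; nra.
Qed.

(** The Stein-Chen method in terms of generating functions.  Put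
    [phi t = E (1 - t) ^ M] with [M] the number of events that occur.  Then
    [- phi' t] is the sum over [e] of [E (1_e (1 - t) ^ (M - 1))].  Replace
    [M - 1] by the number [M'] of occurring events outside the neighbourhood of [e],
    which is independent of [e], and then [M'] by [M]: the sum becomes [L * phi t]
    with [L = E M].  Each replacement costs at most [t] times the expected number of
    discarded events, whence [|phi' + L phi| <= t b], where [b] is the sum of the two
    usual Stein-Chen error terms: pairs of neighbouring events occurring together,
    and products of their probabilities.  Integrating [exp (L t) phi t] from 0 gives
    the bound. *)
Lemma stein_chen_pgf (R : realType) (Om E : finType) (w : Om -> R)
    (m : Om -> E -> bool) (nb : E -> pred E) (q : E -> R) (th : R) :
  (forall x, 0 <= w x) -> \sum_x w x = 1 -> (forall e, nb e e) ->
  (forall e, \sum_x w x * (m x e)%:R = q e) ->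
  (forall e (u : R),
    \sum_x w x * (m x e)%:R * u ^+ (\sum_(f | ~~ nb e f) m x f)%N =
    q e * \sum_x w x * u ^+ (\sum_(f | ~~ nb e f) m x f)%N) ->
  0 <= th <= 1 ->
  `|\sum_x w x * (1 - th) ^+ (\sum_e m x e)%N - expR (- (th * \sum_e q e))| <=
  th ^+ 2 *
    \sum_e (\sum_(f | nb e f && (f != e)) \sum_x w x * (m x e && m x f)%:R
            + q e * \sum_(f | nb e f) q f).
Proof.
move=> w0 w1 nbee qE indep /andP[th0 th1].
set b := (X in _ <= _ * X).
pose L := \sum_e q e.
pose M x := (\sum_e m x e)%N.
have q0 e : 0 <= q e.
  by rewrite -qE; apply: sumr_ge0 => x _; rewrite mulr_ge0// ler0n.
have b0 : 0 <= b.
  apply: sumr_ge0 => e _; apply: addr_ge0.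
    by apply: sumr_ge0 => f _; apply: sumr_ge0 => x _; rewrite mulr_ge0// ler0n.
  by rewrite mulr_ge0// sumr_ge0.
pose phi : {poly R} := \sum_x w x *: (1 - 'X) ^+ M x.
have phiE t : phi.[t] = \sum_x w x * (1 - t) ^+ M x.
  rewrite horner_sum; apply: eq_bigr => x _.
  by rewrite hornerZ horner_exp !hornerE.
have dphiE t : phi^`().[t] = - \sum_e \sum_x w x * (m x e)%:R * (1 - t) ^+ (M x).-1.
  rewrite /phi raddf_sum/= horner_sum exchange_big/= -sumrN; apply: eq_bigr => x _.
  rewrite derivZ hornerZ deriv_exp -!mulr_suml -mulr_sumr -natr_sum -/(M x).
  rewrite hornerMn hornerM horner_exp derivB derivX derivC sub0r hornerN.
  by rewrite !hornerE -[in RHS]mulrA -mulrN mulN1r mulr_natl mulNrn.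
(* The comparison with [M'], one event [e] at a time: S2 is the contribution of
   [e] to [- phi' t], and [q e * S] is what it becomes after the first replacement. *)
have key t : 0 <= t <= 1 -> `|L * phi.[t] + phi^`().[t]| <= t * b.
  move=> /andP[t0 t1].
  have u01 : 0 <= 1 - t <= 1 by apply/andP; split; lra.
  rewrite phiE dphiE /L mulr_suml -sumrB /b mulr_sumr.
  apply: le_trans (ler_norm_sum _ _ _) _; apply: ler_sum => e _.
  pose M' x := (\sum_(f | ~~ nb e f) m x f)%N.
  pose K x := (\sum_(f | nb e f && (f != e)) m x f)%N.
  have MK x : M x = (M' x + (K x + m x e))%N.
    rewrite /M (bigID (nb e))/= addnC; congr (_ + _)%N.
    by rewrite (bigD1 e)//= addnC.
  have /= ind := indep e (1 - t); rewrite -/M' in ind.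
  set S := (X in _ * X) in ind.
  pose S1 := \sum_x w x * (1 - t) ^+ M x.
  pose S2 := \sum_x w x * (m x e)%:R * (1 - t) ^+ (M x).-1.
  rewrite -/S1 -/S2.
  have Ha : 0 <= q e * S - S2 <=
     t * \sum_(f | nb e f && (f != e)) \sum_x w x * (m x e && m x f)%:R.
    rewrite -ind /S2 -sumrB exchange_big/= mulr_sumr.
    suff H x : 0 <= w x * (m x e)%:R * (1 - t) ^+ M' x -
        w x * (m x e)%:R * (1 - t) ^+ (M x).-1 <=
        t * \sum_(f | nb e f && (f != e)) w x * (m x e && m x f)%:R.
      apply/andP; split; first by apply: sumr_ge0 => x _; case/andP: (H x).
      by apply: ler_sum => x _; case/andP: (H x).
    rewrite MK -mulr_sumr; have := w0 x; set wx := w x => wx0.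
    case: (m x e) => /=; last first.
      by rewrite mulr0 !mul0r subrr big1 ?mulr0 ?lexx.
    rewrite addn1 addnS/= mulr1 -natr_sum -/(K x).
    have /andP[h1 h2] := exprB_bernoulli (M' x) (K x) u01.
    by rewrite -mulrBr mulr_ge0//= mulrCA ler_wpM2l//; lra.
  have Hb : 0 <= q e * S - q e * S1 <= t * (q e * \sum_(f | nb e f) q f).
    rewrite -mulrBr -sumrB.
    have -> : \sum_(f | nb e f) q f = \sum_x w x * (K x + m x e)%N%:R.
      under eq_bigr do rewrite -qE.
      rewrite exchange_big/=; apply: eq_bigr => x _.
      rewrite -mulr_sumr -natr_sum; congr (_ * _%:R).
      by rewrite (bigD1 e)//= addnC.
    suff H x : 0 <= w x * (1 - t) ^+ M' x - w x * (1 - t) ^+ M x <=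
        t * (w x * (K x + m x e)%N%:R).
      apply/andP; split.
        by rewrite mulr_ge0// sumr_ge0// => x _; case/andP: (H x).
      rewrite mulrCA ler_wpM2l// mulr_sumr.
      by apply: ler_sum => x _; case/andP: (H x).
    rewrite MK.
    have /andP[h1 h2] := exprB_bernoulli (M' x) (K x + m x e) u01.
    by rewrite -mulrBr mulr_ge0//= mulrCA ler_wpM2l//; lra.
  rewrite ler_norml; apply/andP; split; lra.
have [->|thn0] := eqVneq th 0.
  rewrite mul0r oppr0 expR0 expr0n/= mul0r addr0.
  by under eq_bigr do rewrite expr1n mulr1; rewrite w1 subrr normr0.
have thp : 0 < th by rewrite lt_neqAle eq_sym thn0.
pose G t : R := expR (L * t) * phi.[t].
pose dG t : R := expR (L * t) * (L * phi.[t] + phi^`().[t]).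
have dGP (t : R) : is_derive t (1 : R) G (dG t).
  have h1 := is_derive_poly phi t.
  have h2 : is_derive t (1 : R) (fun t => expR (L * t) : R) (L * expR (L * t)).
    have : is_derive t (1 : R) (horner (L *: 'X)) L.
      have := is_derive_poly (L *: 'X) t.
      by rewrite derivZ derivX hornerZ hornerC mulr1.
    move=> h3; have h4 := @is_derive1_comp R expR (horner (L *: 'X)) t _ _ (is_derive_expR _) h3.
    have -> : (fun t => expR (L * t)) = expR \o horner (L *: 'X).
      by apply/funext => s/=; rewrite hornerZ hornerX.
    apply: is_derive_eq h4 _.
    by rewrite hornerZ hornerX mulrC.
  apply: is_derive_eq (is_deriveM h2 h1) _.
  by rewrite /dG /= mulrDr addrC /GRing.scale/= (mulrC L) (mulrC phi.[t]) -mulrA.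
have [|xi] := MVT thp (fun t _ => dGP t).
  apply: derivable_within_continuous => t _.
  by case: (dGP t).
rewrite in_itv/= => /andP[xi0 xi1].
rewrite subr0 {1 2}/G mulr0 expR0 mul1r.
have -> : phi.[0] = 1.
  by rewrite phiE; under eq_bigr do rewrite subr0 expr1n mulr1.
move=> HG.
have L0 : 0 <= L by exact: sumr_ge0.
rewrite -phiE -/L expRN (mulrC th).
have eL := expR_gt0 (L * th).
rewrite -(ler_pM2l eL) -{1}(gtr0_norm eL) -normrM mulrBr divff ?gt_eqF// HG.
rewrite normrM (gtr0_norm thp) /dG normrM (gtr0_norm (expR_gt0 _)).
have xi01 : 0 <= xi <= 1 by apply/andP; split; lra.
have hk := key _ xi01.
have he : expR (L * xi) <= expR (L * th) by rewrite ler_expR ler_wpM2l// ltW.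
have hx : xi * b <= th * b by rewrite ler_wpM2r// ltW.
rewrite [X in _ <= X](_ : _ = expR (L * th) * (th * b) * th); last by ring.
rewrite ler_wpM2r//.
by apply: ler_pM => //; exact: le_trans hk hx.
Qed.

(** * Averages over colourings *)

Definition mono_on n c (U : {set 'I_n}) (x : coloring n c) : bool :=
  [forall v in U, forall v' in U, x v == x v'].

Lemma mono_onP n c (U : {set 'I_n}) (x : coloring n c) :
  reflect {in U &, forall v v', x v = x v'} (mono_on U x).
Proof.
apply: (iffP forall_inP) => H v; first by move=> v' /H /forall_inP h /h /eqP.
by move=> vU; apply/forall_inP => v' v'U; apply/eqP; exact: H.
Qed.

(** Recolouring all of [U] with the colour of [u0] maps colourings onto those
    that are constant on [U], each fibre having [c ^ (#|U| - 1)] elements, and does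
    not affect [g].  This contains both the probability that [U] is monochromatic
    and the independence of that event from the colours outside [U]. *)
Lemma sum_mono_on (R : nzRingType) n c (U : {set 'I_n}) (u0 : 'I_n)
    (g : coloring n c -> R) :
  u0 \in U -> (forall x y : coloring n c, {in ~: U, x =1 y} -> g x = g y) ->
  \sum_x g x = c%:R ^+ #|U|.-1 * \sum_(x | mono_on U x) g x.
Proof.
move=> u0U ginv.
pose flat (x : coloring n c) : coloring n c :=
  [ffun v => if v \in U then x u0 else x v].
rewrite (partition_big flat (mono_on U)) /=; last first.
  by move=> x _; apply/mono_onP => v v' vU v'U; rewrite !ffunE vU v'U.
rewrite mulr_sumr; apply: eq_bigr => y /mono_onP ymono.
transitivity (\sum_(x | flat x == y) g y).
  apply: eq_bigr => x /eqP <-; apply: ginv => v.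
  by rewrite inE ffunE => /negbTE ->.
rewrite sumr_const -[LHS]mulr_natl; congr (_ * _).
pose F (v : 'I_n) : pred 'I_c := if v \in U :\ u0 then predT else pred1 (y v).
have -> : #|[pred x | flat x == y]| = #|family F|.
  apply: eq_card => x; rewrite !inE; apply/eqP/familyP => [xy v|xF].
    rewrite /F -xy !inE ffunE; case: ifP => // /negbT.
    by rewrite negb_and negbK => /orP[/eqP ->|/negbTE ->]; rewrite ?u0U inE.
  have xu0 : x u0 = y u0.
    by have := xF u0; rewrite /F !inE eqxx/= inE => /eqP.
  apply/ffunP => v; rewrite ffunE; case: ifP => vU; first by rewrite xu0; exact: ymono.
  by have := xF v; rewrite /F !inE vU andbF inE => /eqP.
rewrite card_family foldrE big_map big_enum/=.
rewrite (bigID (mem (U :\ u0)))/= [X in (_ * X)%N]big1 ?muln1; last first.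
  by move=> v /negbTE vU; rewrite /F vU card1.
rewrite (eq_bigr (fun=> c)); last by move=> v vU; rewrite /F vU card_ord.
by rewrite prod_nat_const natrX; congr (_ ^+ _); rewrite [in RHS](cardsD1 u0) u0U.
Qed.

Section coloring_average.
Variables (R : realFieldType) (n c : nat).

Definition avg (g : coloring n c -> R) : R := (c%:R ^+ n)^-1 * \sum_x g x.

Hypothesis c0 : (0 < c)%N.

Lemma avg_mono_on (U : {set 'I_n}) (u0 : 'I_n) (g : coloring n c -> R) :
  u0 \in U -> (forall x y : coloring n c, {in ~: U, x =1 y} -> g x = g y) ->
  avg (fun x => (mono_on U x)%:R * g x) = (c%:R ^+ #|U|.-1)^-1 * avg g.
Proof.
move=> u0U ginv; rewrite /avg (sum_mono_on u0U ginv) [RHS]mulrCA mulKf; last first.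
  by rewrite expf_neq0// pnatr_eq0 -lt0n.
congr (_ * _); rewrite [RHS]big_mkcond/=; apply: eq_bigr => x _.
by case: mono_on; rewrite ?mul1r ?mul0r.
Qed.

Lemma avg1 : avg (fun=> 1) = 1.
Proof.
rewrite /avg sumr_const.
rewrite (_ : #|_| = #|{: coloring n c}|)//.
by rewrite card_ffun !card_ord natrX mulVf// expf_neq0// pnatr_eq0 -lt0n.
Qed.

Lemma avg_mono (U : {set 'I_n}) (u0 : 'I_n) :
  u0 \in U -> avg (fun x => (mono_on U x)%:R) = (c%:R ^+ #|U|.-1)^-1.
Proof.
move=> u0U; have := @avg_mono_on U u0 (fun=> 1) u0U (fun _ _ _ => erefl).
by rewrite avg1 mulr1 => <-; congr avg; apply/funext => x; rewrite mulr1.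
Qed.

End coloring_average.

Lemma monochromaticE r n c (x : coloring n c) (e : edge r n) :
  monochromatic x e = mono_on (val e) x.
Proof. by []. Qed.

(** Two overlapping monochromatic sets share their colour, so the joint event
    is again of the form handled by [avg_mono]. *)
Lemma mono_onU n c (U V : {set 'I_n}) (v0 : 'I_n) (x : coloring n c) :
  v0 \in U -> v0 \in V -> mono_on U x && mono_on V x = mono_on (U :|: V) x.
Proof.
move=> vU vV; apply/andP/mono_onP => [[/mono_onP mU /mono_onP mV]|mUV].
  suff H v : v \in U :|: V -> x v = x v0 by move=> v v' /H -> /H ->.
  by rewrite inE => /orP[vU'|vV']; [exact: mU|exact: mV].
by split; apply/mono_onP => v v' h h'; apply: mUV; rewrite inE ?h ?h' ?orbT.
Qed.

(** * Monochromatic edges of the complete hypergraph *)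

Lemma bin_le_expn n m : ('C(n, m) <= n ^ m)%N.
Proof.
apply: (@leq_trans (n ^_ m)); first by rewrite -bin_ffact leq_pmulr// fact_gt0.
by elim: m => // m IH; rewrite ffactnSr expnSr leq_mul// leq_subr.
Qed.

Definition overlap r n (e f : edge r n) : bool := val e :&: val f != finset.set0.

Lemma edge_card r n (e : edge r n) : #|val e| = r.
Proof. exact/eqP/(valP e). Qed.

Lemma overlap_card r n (e f : edge r n) :
  overlap e f -> f != e -> (0 < #|val f :\: val e| < r)%N.
Proof.
move=> ef fe; apply/andP; split.
  rewrite card_gt0; apply: contra fe; rewrite finset.setD_eq0 => fe.
  by apply/eqP/val_inj/eqP; rewrite eqEcard fe !edge_card/=.
rewrite -[ltnRHS](edge_card f) -(cardsID (val e) (val f)) -[ltnLHS]add0n ltn_add2r.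
by rewrite card_gt0 finset.setIC.
Qed.

(** An edge [f] is determined by its trace on [e], for which there are at most
    [2 ^ r] choices, and by [f] minus [e], a nonempty set of [m < r] vertices, for
    which there are at most [n ^ m] choices. *)
Lemma sum_overlap (R : realFieldType) r n (e : edge r n) (y : R) : 0 <= y ->
  \sum_(f | overlap e f && (f != e)) y ^+ #|val f :\: val e| <=
  2 ^+ r * \sum_(m < r | (0 < m)%N) (n%:R * y) ^+ m.
Proof.
move=> y0.
pose S := {set 'I_n}.
pose split (f : edge r n) : S * S := (val f :&: val e, val f :\: val e).
have split_inj : injective split.
  move=> f f' [h1 h2]; apply: val_inj.
  by rewrite -(finset.setID (val f) (val e)) h1 h2 finset.setID.
pose Q (b : S) := (0 < #|b| < r)%N.
pose F (b : S) : R := y ^+ #|b|.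
have F0 b : 0 <= F b by rewrite exprn_ge0.
apply: (@le_trans _ _ (\sum_(a in powerset (val e)) \sum_(b | Q b) F b)).
  rewrite pair_big/=.
  rewrite (eq_bigr (fun f => F (split f).2))//.
  rewrite -(big_imset (fun p : S * S => F p.2)) /=; last first.
    by move=> f f' _ _; exact: split_inj.
  rewrite big_mkcond [leRHS]big_mkcond; apply: ler_sum => p _.
  case: ifPn => [/imsetP[f fQ ->]|_]; last by case: ifP.
  rewrite ifT//= powersetE finset.subsetIr/=.
  by move: fQ; rewrite unfold_in => /andP[? ?]; exact: overlap_card.
rewrite sumr_const card_powerset edge_card -[leLHS]mulr_natl natrX ler_wpM2l//.
apply: (@le_trans _ _ (\sum_(b | Q b) \sum_(m < r | (0 < m)%N && (#|b| == m)) y ^+ m)).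
  apply: ler_sum => b /andP[b0 br].
  rewrite (big_pred1 (Ordinal br))//= => m.
  rewrite (_ : pred1 (Ordinal br) m = (#|b| == m)); last exact: eq_sym.
  by case: eqP => [<-|]; rewrite ?b0 ?andbF.
rewrite (exchange_big_dep (fun m : 'I_r => 0 < m)%N)/=; last by move=> b m _ /andP[].
apply: ler_sum => m m0.
rewrite sumr_const -[leLHS]mulr_natl exprMn ler_wpM2r ?exprn_ge0// -natrX ler_nat.
apply: leq_trans (bin_le_expn n m); rewrite -[in leqRHS](card_ord n) -card_draws.
by apply: subset_leq_card; apply/fintype.subsetP => b; rewrite !inE => /andP[_ /andP[]].
Qed.

Lemma card_edge r n : #|edge r n| = 'C(n, r).
Proof.
by rewrite card_sig -[n in RHS]card_ord -card_draws; apply: eq_card => e; rewrite !inE.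
Qed.

(** The Poisson approximation of the number of monochromatic edges of the
    complete [r]-uniform hypergraph.  Two edges are neighbours when they meet; such
    a pair is monochromatic with probability [c ^ (1 - #|e :|: f|)], that is
    [c ^ (1 - r)] times [c ^ (- #|f :\: e|)], and the product of the two separate
    probabilities is smaller.  Hence both error terms are controlled by
    [sum_overlap] with [y = 1 / c]; the last summand is the diagonal [e = f]. *)
Lemma mono_count_pgf (R : realType) r n c (th : R) :
  (2 <= r)%N -> (0 < c)%N -> 0 <= th <= 1 ->
  `|avg (fun x : coloring n c => (1 - th) ^+ (\sum_(e : edge r n) monochromatic x e)%N)
    - expR (- (th * ('C(n, r)%:R / c%:R ^+ (r - 1))))| <=
  th ^+ 2 * ('C(n, r)%:R / c%:R ^+ (r - 1) *
    (2 * (2 ^+ r * \sum_(m < r | (0 < m)%N) (n%:R / c%:R) ^+ m)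
     + (c%:R ^+ (r - 1))^-1)).
Proof.
move=> r2 c0 th01.
have cp : 0 < (c%:R : R) by rewrite ltr0n.
have c1 : 1 <= (c%:R : R) by rewrite ler1n.
have mE (e : edge r n) : exists v, v \in val e.
  by apply/set0Pn; rewrite -card_gt0 edge_card; exact: leq_trans r2.
set q : R := (c%:R ^+ (r - 1))^-1.
have q0 : 0 <= q by rewrite invr_ge0 exprn_ge0// ltW.
pose w (x : coloring n c) : R := (c%:R ^+ n)^-1.
pose m (x : coloring n c) (e : edge r n) := monochromatic x e.
have avgE g : avg g = \sum_x w x * g x by rewrite /avg mulr_sumr.
have qE (e : edge r n) : \sum_x w x * (m x e)%:R = q.
  have [v ve] := mE e.
  by rewrite -avgE /m (avg_mono _ c0 ve) edge_card -subn1.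
have overlapE (e f : edge r n) v : overlap e f = false -> v \in val f -> v \in ~: val e.
  move=> /negbFE/eqP ef vf; rewrite inE; apply/negP => ve.
  have : v \in val e :&: val f by rewrite inE ve.
  by rewrite ef inE.
have main := @stein_chen_pgf R _ _ w m (@overlap r n) (fun=> q) th.
rewrite avgE (_ : 'C(n, r)%:R / _ = \sum_(e : edge r n) q); last first.
  by rewrite sumr_const card_edge mulr_natl.
apply: le_trans (main _ _ _ _ _ th01) _ => //.
- by move=> x; rewrite invr_ge0 exprn_ge0// ltW.
- by have := avg1 R n c0; rewrite avgE; under eq_bigr do rewrite mulr1.
- by move=> e; rewrite /overlap finset.setIid -card_gt0 edge_card (leq_trans _ r2).
- move=> e u; have [v ve] := mE e.
  have := @avg_mono_on R n c c0 (val e) v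
    (fun x => u ^+ (\sum_(f | ~~ overlap e f) m x f)%N) ve.
  rewrite !avgE edge_card -subn1 -/q => <-.
    by apply: eq_bigr => x _; rewrite mulrA.
  move=> x y xy; congr (_ ^+ _); apply: eq_bigr => f ef; congr nat_of_bool.
  have fe v' : v' \in val f -> x v' = y v'.
    by move=> vf; apply: xy; apply: overlapE vf; exact: negbTE.
  by apply/mono_onP/mono_onP => H v1 v2 h1 h2; have := H _ _ h1 h2; rewrite !fe.
rewrite ler_wpM2l ?exprn_ge0//; first by case/andP: th01.
rewrite mulr_suml; apply: ler_sum => e _.
have [v ve] := mE e.
pose D := \sum_(f : edge r n | overlap e f && (f != e)) c%:R^-1 ^+ #|val f :\: val e| : R.
have DB := @sum_overlap R r n e c%:R^-1.
have {}DB := DB (ltW _); rewrite invr_gt0 in DB; have {}DB := DB cp.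
set B := (X in X + q); have HB : 2 * D <= B by rewrite /B ler_wpM2l.
have -> : \sum_(f | overlap e f) q = q + \sum_(f : edge r n| overlap e f && (f != e)) q.
  rewrite (bigD1 e)//= /overlap finset.setIid -card_gt0 edge_card.
  by rewrite (leq_trans _ r2).
have h1 : \sum_(f | overlap e f && (f != e)) \sum_x w x * (m x e && m x f)%:R = q * D.
  rewrite mulr_sumr; apply: eq_bigr => f /andP[ef fe].
  rewrite -avgE; have /set0Pn[v' ] := ef; rewrite inE => /andP[v'e v'f].
  under eq_fun do rewrite /m !monochromaticE (mono_onU _ v'e v'f).
  have v'ef : v' \in val e :|: val f by rewrite inE v'e.
  rewrite (avg_mono _ c0 v'ef) /q exprVn -invfM -exprD; congr (_ ^+ _)^-1.
  have -> : #|val e :|: val f| = (r + #|val f :\: val e|)%N.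
    rewrite -(cardsID (val e)) finset.setUK edge_card; congr (_ + _)%N.
    by rewrite finset.setDUl finset.setDv finset.set0U.
  by rewrite -subn1 addnBAC// ltnW.
have h2 : \sum_(f | overlap e f && (f != e)) q <= D.
  apply: ler_sum => f /andP[ef fe]; rewrite /q -exprVn.
  rewrite ler_wiXn2l ?invf_le1 ?invr_ge0 ?(ltW cp)//.
  by have /andP[_] := overlap_card ef fe; rewrite -[(_ <= r - 1)%N]ltnS subn1 prednK// ltnW.
rewrite h1 -mulrDr ler_wpM2l//.
lra.
Qed.

(** * Means of bounded functions of discrete random elements *)

Definition bounded_fct (R : realType) (S : Type) (phi : S -> R) : Prop :=
  exists M : R, forall s, `|phi s| <= M.

Section bounded_functions.
Variables (R : realType) (S : Type).
Implicit Types (phi psi : S -> R).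

Lemma bounded_cst_fct (a : R) : bounded_fct (fun=> a : R) (S := S).
Proof. by exists `|a|. Qed.

Lemma bounded_add phi psi : bounded_fct phi -> bounded_fct psi ->
  bounded_fct (fun s => phi s + psi s).
Proof.
move=> [M hM] [N hN]; exists (M + N) => s.
by rewrite (le_trans (ler_normD _ _))// lerD.
Qed.

Lemma bounded_mul phi psi : bounded_fct phi -> bounded_fct psi ->
  bounded_fct (fun s => phi s * psi s).
Proof. by move=> [M hM] [N hN]; exists (M * N) => s; rewrite normrM ler_pM. Qed.

Lemma bounded_indic (b : S -> bool) : bounded_fct (fun s => (b s)%:R : R).
Proof. by exists 1 => s; case: (b s); rewrite ?normr1 ?normr0. Qed.

Lemma bounded_sum I (r : seq I) (Q : pred I) (phi : I -> S -> R) :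
  (forall i, bounded_fct (phi i)) ->
  bounded_fct (fun s => \sum_(i <- r | Q i) phi i s).
Proof.
move=> /choice[M hM]; exists (\sum_(i <- r | Q i) M i) => s.
by rewrite (le_trans (ler_norm_sum _ _ _))// ler_sum.
Qed.

End bounded_functions.

Section mean.
Context d (T : measurableType d) (R : realType) (P : probability T R).
Variables (S : Type) (Y : T -> S).
Hypothesis mY : discrete_random_element Y.
Implicit Types phi psi : S -> R.

Definition mean phi : R := \int[P]_w phi (Y w).

Lemma integrable_discrete phi : bounded_fct phi ->
  P.-integrable setT (EFin \o (phi \o Y)).
Proof.
move=> [M hM]; apply: measurable_bounded_integrable => //.
- exact: le_lt_trans (probability_le1 P measurableT) (ltry 1).
- by move=> _ B mB; rewrite setTI; exact: (mY (phi @^-1` B)).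
- by exists M; split; [rewrite num_real|move=> x Mx w _; exact: le_trans (hM _) (ltW Mx)].
Qed.

Lemma expectation_mean phi : bounded_fct phi ->
  ('E_P[phi \o Y] = (mean phi)%:E)%E.
Proof.
move=> bphi; rewrite unlock /mean /Rintegral fineK//.
exact/integrable_fin_num/integrable_discrete.
Qed.

Lemma meanD phi psi : bounded_fct phi -> bounded_fct psi ->
  mean (fun s => phi s + psi s) = mean phi + mean psi.
Proof. by move=> bphi bpsi; apply: RintegralD => //; exact: integrable_discrete. Qed.

Lemma meanZ (a : R) phi : bounded_fct phi -> mean (fun s => a * phi s) = a * mean phi.
Proof. by move=> bphi; apply: RintegralZl => //; exact: integrable_discrete. Qed.

Lemma mean_cst (a : R) : mean (fun=> a) = a.
Proof.
by rewrite /mean Rintegral_cst// [X in fine X](_ : _ = 1%E) ?mulr1//; exact: probability_setT.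
Qed.

Lemma mean_sum I (r : seq I) (Q : pred I) (phi : I -> S -> R) :
  (forall i, bounded_fct (phi i)) ->
  mean (fun s => \sum_(i <- r | Q i) phi i s) = \sum_(i <- r | Q i) mean (phi i).
Proof.
move=> bphi; elim: r => [|i r IH].
  by rewrite big_nil -[RHS](mean_cst 0); congr mean; apply/funext => s; rewrite big_nil.
rewrite big_cons -IH; case: ifPn => Qi; last first.
  by congr mean; apply/funext => s; rewrite big_cons (negbTE Qi).
rewrite -meanD//; last exact: bounded_sum.
by congr mean; apply/funext => s; rewrite big_cons Qi.
Qed.

Lemma mean_le phi psi : bounded_fct phi -> bounded_fct psi ->
  (forall s, phi s <= psi s) -> mean phi <= mean psi.
Proof. by move=> bphi bpsi h; apply: le_Rintegral => //; exact: integrable_discrete. Qed.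

Lemma mean_dist (eps : R) phi psi : bounded_fct phi -> bounded_fct psi ->
  (forall s, `|phi s - psi s| <= eps) -> `|mean phi - mean psi| <= eps.
Proof.
move=> bphi bpsi h.
have be : bounded_fct (fun=> eps : R) (S := S) by exact: bounded_cst_fct.
rewrite ler_distl -{1 2}(mean_cst eps); apply/andP; split.
  rewrite lerBlDr -meanD//; apply: mean_le => //; first exact: bounded_add.
  by move=> s; have := h s; rewrite ler_distl => /andP[]; lra.
rewrite -meanD//; apply: mean_le => //; first exact: bounded_add.
by move=> s; have := h s; rewrite ler_distl => /andP[].
Qed.

Lemma mean_indic (b : S -> bool) : mean (fun s => (b s)%:R) = fine (P (Y @^-1` [set s | b s])).
Proof.
rewrite /mean /Rintegral; congr fine; rewrite -[in RHS](setIT (Y @^-1` _)) -integral_indic//.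
apply: eq_integral => w _; congr EFin; rewrite indicE; congr (nat_of_bool _)%:R.
by apply/idP/idP; rewrite inE.
Qed.

End mean.

Lemma discrete_pair d (T : measurableType d) (S S' : countType) (Y : T -> S) (Y' : T -> S') :
  discrete_random_element Y -> discrete_random_element Y' ->
  discrete_random_element (fun w => (Y w, Y' w)).
Proof.
move=> mY mY' A.
rewrite (_ : _ @^-1` A = \bigcup_(s : S * S')
    (if `[< A s >] then Y @^-1` [set s.1] `&` Y' @^-1` [set s.2] else set0)).
  apply: countable_bigcupT_measurable => // s.
  by case: ifP => // _; exact: measurableI.
apply/seteqP; split => [w Aw|w [s _]].
  by exists (Y w, Y' w) => //; case: asboolP.
by case: asboolP => // As [/= h1 h2]; rewrite h1 h2 -surjective_pairing.
Qed.

Lemma mean_finite d (T : measurableType d) (R : realType) (P : probability T R)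
    (S : finType) (Y : T -> S) (phi : S -> R) : discrete_random_element Y ->
  mean P Y phi = \sum_s phi s * fine (P (Y @^-1` [set s])).
Proof.
move=> mY; transitivity (mean P Y (fun t => \sum_s phi s * (t == s)%:R)).
  congr mean; apply/funext => t; rewrite (bigD1 t)//= eqxx mulr1 big1 ?addr0// => s.
  by rewrite eq_sym => /negbTE ->; rewrite mulr0.
rewrite mean_sum//; last first.
  by move=> s; apply: bounded_mul; [exact: bounded_cst_fct|exact: bounded_indic].
apply: eq_bigr => s _; rewrite meanZ//; last exact: bounded_indic.
rewrite mean_indic//; congr (_ * fine (P (Y @^-1` _))).
by apply/seteqP; split => t /= /eqP.
Qed.

(** * Convergence in law from generating functions *)

(** That a set [C] of test functions contains a given function is deduced below
    from generators of [C] through these two closure properties alone. *)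
Record uniformly_closed_space (R : realType) (S : Type) (C : (S -> R) -> Prop) : Prop :=
  UniformlyClosedSpace {
  ucs_lin : forall a b f g, C f -> C g -> C (fun k => a * f k + b * g k);
  ucs_lim : forall f,
    (forall eps, 0 < eps -> exists2 g, C g & forall k, `|f k - g k| <= eps) -> C f }.

Lemma ucs_sum (R : realType) (S : Type) (C : (S -> R) -> Prop) (I : Type) (r : seq I)
    (a : I -> R) (f : I -> S -> R) (g0 : S -> R) :
  uniformly_closed_space C -> C g0 -> (forall i, C (f i)) ->
  C (fun k => \sum_(i <- r) a i * f i k).
Proof.
move=> Clos Cg0 Cf; elim: r => [|i r IH].
  rewrite (_ : (fun _ => _) = (fun k => 0 * g0 k + 0 * g0 k)).
    exact: (ucs_lin Clos).
  by apply/funext => k; rewrite big_nil !mul0r addr0.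
rewrite (_ : (fun _ => _) = (fun k => a i * f i k + 1 * \sum_(i <- r) a i * f i k)).
  exact: (ucs_lin Clos).
by apply/funext => k; rewrite big_cons mul1r.
Qed.

(** As [s] tends to 0, the functions [k |-> s ^ k] isolate the smallest values
    of [k]: once the indicators of all [j < a] have been subtracted from [s ^ k], what
    remains, divided by [s ^ a], is 1 at [a], 0 below and at most [s] above. *)
Lemma ucs_indic (R : realType) (C : (nat -> R) -> Prop) :
  uniformly_closed_space C -> (forall s, 0 <= s < 1 -> C (fun k => s ^+ k)) ->
  forall a, C (fun k => (k == a)%:R).
Proof.
move=> Clos Cpow; elim/ltn_ind => a IH; apply: (ucs_lim Clos) => e e0.
pose s := Num.min e (1 / 2).
have s0 : 0 < s by rewrite lt_min e0/=; lra.
have s1 : s < 1 by rewrite gt_min; apply/orP; right; lra.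
have C0 : C (fun k => s ^+ k) by apply: Cpow; rewrite ltW.
exists (fun k => s ^- a * s ^+ k + (- s ^- a) * \sum_(j < a) s ^+ j * (k == j)%:R).
  apply: (ucs_lin Clos) => //.
  by apply: (@ucs_sum _ _ _ _ _ (fun j : 'I_a => s ^+ j) _ _ Clos C0) => j; exact: IH.
move=> k; have [ka|ka|->] := ltngtP k a.
- rewrite (bigD1 (Ordinal ka))//= eqxx big1 ?addr0; last first.
    by move=> j; rewrite -val_eqE/= eq_sym => /negbTE ->; rewrite mulr0.
  by rewrite mulr1 sub0r mulNr subrr oppr0 normr0 ltW.
- rewrite big1 ?mulr0 ?addr0; last first.
    by move=> j _; rewrite gtn_eqF ?mulr0//; exact: ltn_trans ka.
  rewrite sub0r normrN mulrC -expfB// ger0_norm ?exprn_ge0 ?(ltW s0)//.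
  have := ka; rewrite -subn_gt0; case: (k - a)%N => // m _.
  have se : s <= e by rewrite ge_min lexx.
  rewrite exprS; apply: le_trans se.
  by rewrite ler_piMr ?exprn_ile1 ?ltW.
- rewrite big1 ?mulr0 ?addr0; last by move=> j _; rewrite gtn_eqF ?mulr0.
  by rewrite mulVf ?subrr ?normr0 ?ltW// expf_neq0// gt_eqF.
Qed.

Section pgf_continuity.
Context (R : realType) (d : nat -> measure_display) (T : forall n, measurableType (d n))
  (P : forall n, probability (T n) R) (Y : forall n, T n -> nat * nat)
  (d' : measure_display) (T' : measurableType d') (P' : probability T' R)
  (Y' : T' -> nat * nat).
Hypotheses (mY : forall n, discrete_random_element (@Y n)) (mY' : discrete_random_element Y').
Hypothesis pgf_cvg : forall s t : R, 0 <= s < 1 -> 0 <= t < 1 ->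
  (fun n => mean (P n) (@Y n) (fun k => s ^+ k.1 * t ^+ k.2)) @ \oo -->
  mean P' Y' (fun k => s ^+ k.1 * t ^+ k.2).

Let conv (phi : nat * nat -> R) := bounded_fct phi /\
  (fun n => mean (P n) (@Y n) phi) @ \oo --> mean P' Y' phi.

Let conv_closed : uniformly_closed_space conv.
Proof.
split=> [a b f g [bf cf] [bg cg]|f lim].
  have baf : bounded_fct (fun k => a * f k).
    by apply: bounded_mul => //; exact: bounded_cst_fct.
  have bbg : bounded_fct (fun k => b * g k).
    by apply: bounded_mul => //; exact: bounded_cst_fct.
  split; first exact: bounded_add.
  rewrite meanD// !meanZ//.
  under eq_fun do rewrite meanD// !meanZ//.
  by apply: cvgD; apply: cvgMr.
have bf : bounded_fct f.
  have [g [[M bg] _] fg] := lim 1 ltr01; exists (1 + M) => k.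
  rewrite -(subrK (g k) (f k)) (le_trans (ler_normD _ _))// lerD//.
split=> //; apply/cvgrPdist_le => e e0.
have e3 : 0 < e / 3 by rewrite divr_gt0.
have [g [bg cg] fg] := lim _ e3.
have /cvgrPdist_le/(_ _ e3) := cg; apply: filterS => n hn.
have h1 := mean_dist P' mY' bf bg fg.
have h2 := mean_dist (P n) (mY n) bf bg fg.
move: hn h1 h2; rewrite !ler_distl => /andP[? ?] /andP[? ?] /andP[? ?].
by apply/andP; split; lra.
Qed.

(* The generating functions are separated one variable at a time. *)
Let conv_indic a b : conv (fun k => (k.1 == a)%:R * (k.2 == b)%:R).
Proof.
have pow01 (t : R) j : 0 <= t < 1 -> `|t ^+ j| <= 1.
  by move=> /andP[t0 t1]; rewrite ger0_norm ?exprn_ge0// exprn_ile1// ltW.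
have step1 t : 0 <= t < 1 -> conv (fun k => (k.1 == a)%:R * t ^+ k.2).
  move=> t01.
  pose C (f : nat -> R) := conv (fun k => f k.1 * t ^+ k.2).
  suff : C (fun k => (k == a)%:R) by [].
  apply: ucs_indic => [|s s01]; last first.
    split; last exact: pgf_cvg.
    by exists 1 => k; rewrite normrM mulr_ile1// pow01.
  split=> [x y f g Cf Cg|f lim]; rewrite /C.
    under eq_fun do rewrite mulrDl -!mulrA.
    exact: (ucs_lin conv_closed).
  apply: (ucs_lim conv_closed) => e e0; have [g Cg fg] := lim e e0.
  exists (fun k => g k.1 * t ^+ k.2) => // k.
  rewrite -mulrBl normrM -[leRHS]mulr1 ler_pM//; exact: pow01.
pose C (f : nat -> R) := conv (fun k => (k.1 == a)%:R * f k.2).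
suff : C (fun k => (k == b)%:R) by [].
apply: ucs_indic => //.
split=> [x y f g Cf Cg|f lim]; rewrite /C.
  under eq_fun do rewrite mulrDr !(mulrCA _%:R).
  exact: (ucs_lin conv_closed).
apply: (ucs_lim conv_closed) => e e0; have [g Cg fg] := lim e e0.
exists (fun k => (k.1 == a)%:R * g k.2) => // k.
rewrite -mulrBr normrM -[leRHS]mul1r ler_pM//.
by case: eqP; rewrite ?normr1 ?normr0.
Qed.

Let box N (k : nat * nat) : bool := (k.1 < N)%N && (k.2 < N)%N.

Let box_decomposition N (phi : nat * nat -> R) k :
  (box N k)%:R * phi k =
  \sum_(ij : 'I_N * 'I_N) phi (ij.1 : nat, ij.2 : nat) *
    ((k.1 == ij.1)%:R * (k.2 == ij.2)%:R).
Proof.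
case: k => k1 k2; rewrite /box /=; case: (ltnP k1 N) => h1 /=; last first.
  rewrite mul0r big1// => -[i j] _ /=.
  by rewrite [k1 == _]gtn_eqF ?mul0r ?mulr0//; exact: leq_trans h1.
case: (ltnP k2 N) => h2; last first.
  rewrite mul0r big1// => -[i j] _ /=.
  by rewrite [k2 == _]gtn_eqF ?mulr0//; exact: leq_trans h2.
rewrite (bigD1 (Ordinal h1, Ordinal h2))//= !eqxx !mulr1 mul1r big1 ?addr0//.
move=> [i j] /=; apply: contraNeq; rewrite !mulf_eq0 !pnatr_eq0 !eqb0 !negb_or !negbK.
by move=> /andP[_ /andP[/eqP h3 /eqP h4]]; apply/eqP; congr pair; exact: val_inj.
Qed.

Let conv_box N phi : conv (fun k => (box N k)%:R * phi k).
Proof.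
under eq_fun do rewrite box_decomposition.
apply: (@ucs_sum _ _ _ _ _ (fun ij : 'I_N * 'I_N => phi (ij.1 : nat, ij.2 : nat))
  _ _ conv_closed (conv_indic 0 0)) => ij.
exact: conv_indic.
Qed.

(* Tightness of the limit law; that of the approximating laws follows from the
   convergence of their masses on each box. *)
Let mean_box : (fun N => mean P' Y' (fun k => (box N k)%:R)) @ \oo --> (1 : R).
Proof.
have mF N : measurable (Y' @^-1` [set k | box N k]) by exact: mY'.
have UF : \bigcup_N (Y' @^-1` [set k | box N k]) = setT.
  apply/seteqP; split => // w _.
  exists (maxn (Y' w).1 (Y' w).2).+1 => //=.
  by rewrite /box !ltnS leq_maxl leq_maxr.
under eq_fun do rewrite mean_indic//.
apply: (@fine_cvg R nat \oo _ (fun N => P' (Y' @^-1` [set k | box N k])) 1).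
rewrite -(probability_setT P') -UF; apply: nondecreasing_cvg_mu => //.
  by rewrite UF.
move=> m p mp; apply/subsetPset => w /= /andP[h1 h2].
by apply/andP; split; exact: leq_trans mp.
Qed.

(** The continuity theorem for bivariate generating functions.  The functions
    whose means converge form a uniformly closed space containing all
    [s ^ k.1 * t ^ k.2], hence all indicators of points and all functions supported
    in a box; outside a large box the limit law, and so eventually each
    approximating law, has little mass.  Convergence holds for every bounded
    function since the values lie in a discrete space. *)
Theorem cvg_mean_of_cvg_pgf phi : bounded_fct phi ->
  (fun n => mean (P n) (@Y n) phi) @ \oo --> mean P' Y' phi.
Proof.
move=> bphi; have [M0 hM0] := bphi.
pose M := `|M0| + 1.
have M1 : 0 < M by rewrite ltr_wpDl.
have hM k : `|phi k| <= M by rewrite (le_trans (hM0 k))// (le_trans (ler_norm _))// lerDl.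
apply/cvgrPdist_le => e e0.
have e4 : 0 < e / (4 * M) by rewrite divr_gt0// mulr_gt0.
have e4M : 4 * (M * (e / (4 * M))) = e by field; rewrite gt_eqF.
set z := e / (4 * M) in e4 e4M.
(* N is chosen so that the limit law puts mass at most z outside the box *)
have /cvgrPdist_le/(_ _ e4)/filter_ex[N] := mean_box.
rewrite ler_distl => /andP[_ hN].
have [bb cb] := conv_box N (fun=> 1).
have [bbp cbp] := conv_box N phi.
have Me4 : 0 < M * z by rewrite mulr_gt0.
have /cvgrPdist_le/(_ _ e4) := cb; have /cvgrPdist_le/(_ _ Me4) := cbp.
apply: filterS2 => n h1 h2.
have bc : bounded_fct (fun=> M : R) (S := (nat * nat)%type) by exact: bounded_cst_fct.
have outside d0 (T0 : measurableType d0) (P0 : probability T0 R) (Y0 : T0 -> nat * nat) :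
    discrete_random_element Y0 ->
    `|mean P0 Y0 phi - mean P0 Y0 (fun k => (box N k)%:R * phi k)| <=
    M - M * mean P0 Y0 (fun k => (box N k)%:R * 1).
  move=> m0.
  have bMb : bounded_fct (fun k => - M * ((box N k)%:R * 1)).
    by apply: bounded_mul => //; exact: bounded_cst_fct.
  have bout : bounded_fct (fun k => M + - M * ((box N k)%:R * 1)) by exact: bounded_add.
  have <- : mean P0 Y0 (fun k => M + - M * ((box N k)%:R * 1)) =
            M - M * mean P0 Y0 (fun k => (box N k)%:R * 1).
    by rewrite meanD// meanZ// mean_cst mulNr.
  rewrite ler_distl; apply/andP; split.
    rewrite lerBlDr -meanD//; apply: mean_le => //; first exact: bounded_add.
    by move=> k; have := hM k; rewrite ler_norml => /andP[]; case: box => /=; lra.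
  rewrite -meanD//; apply: mean_le => //; first exact: bounded_add.
  by move=> k; have := hM k; rewrite ler_norml => /andP[]; case: box => /=; lra.
have o1 := outside _ _ P' _ mY'; have o2 := outside _ _ (P n) _ (mY n).
have boxE : mean P' Y' (fun k => (box N k)%:R * 1) = mean P' Y' (fun k => (box N k)%:R).
  by congr mean; apply/funext => k; rewrite mulr1.
(* The four errors, in units of [M * z]: one each for the values on the box and for
   the limit law outside it, two for the approximating law outside it. *)
move: h1 h2 o1 o2; rewrite boxE !ler_distl.
set a := mean P' Y' (fun k => (box N k)%:R) in hN *.
set b := mean (P n) _ (fun k => (box N k)%:R * 1).
move=> /andP[? ?] /andP[g1 g2] /andP[? ?] /andP[? ?].
have Ma : M * (1 - z) <= M * a by rewrite ler_wpM2l ?(ltW M1)//; lra.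
have Mb : M * (a - z) <= M * b by rewrite ler_wpM2l ?(ltW M1)//; lra.
by rewrite !mulrBr mulr1 in Ma Mb; apply/andP; split; lra.
Qed.

End pgf_continuity.

(** * Independent Poisson variables *)

Lemma geom_truncation (R : realFieldType) (s : R) (N k : nat) : 0 <= s <= 1 ->
  `|\sum_(j < N) s ^+ j * (k == j :> nat)%:R - s ^+ k| <= s ^+ N.
Proof.
move=> /andP[s0 s1]; case: (ltnP k N) => kN.
  rewrite (bigD1 (Ordinal kN))//= eqxx mulr1 big1 ?addr0 ?subrr ?normr0 ?exprn_ge0//.
  by move=> j; rewrite -val_eqE/= eq_sym => /negbTE ->; rewrite mulr0.
rewrite big1 ?sub0r ?normrN; last first.
  by move=> j _; rewrite gtn_eqF ?mulr0//; exact: leq_trans kN.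
by rewrite ger0_norm ?exprn_ge0// ler_wiXn2l.
Qed.

(** The converse of [ucs_indic]: a geometric sequence is summable, so its
    truncations converge to it uniformly. *)
Lemma ucs_geom (R : realType) (C : (nat -> R) -> Prop) (s : R) :
  uniformly_closed_space C -> (forall a, C (fun k => (k == a)%:R)) -> 0 <= s < 1 ->
  C (fun k => s ^+ k).
Proof.
move=> Clos Cind /andP[s0 s1]; apply: (ucs_lim Clos) => e e0.
have : s ^+ n @[n --> \oo] --> 0 by apply: cvg_expr; rewrite ger0_norm.
move=> /cvgrPdist_le/(_ _ e0)/filter_ex[N].
rewrite sub0r normrN (ger0_norm (exprn_ge0 _ _))// => hN.
exists (fun k : nat => \sum_(j < N) s ^+ j * (k == j :> nat)%:R).
  exact: (@ucs_sum _ _ _ _ _ (fun j : 'I_N => s ^+ j) _ _ Clos (Cind 0)).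
by move=> k; rewrite distrC (le_trans _ hN)// geom_truncation// s0 ltW.
Qed.

Section independent_pgf.
Context d (T : measurableType d) (R : realType) (P : probability T R).

(** Factorization of a mean passes to uniform limits; with [ucs_indic] and
    [ucs_geom], a factorization known for indicators extends to powers. *)
Lemma ucs_mean_mul (S : Type) (W : T -> S) (pi : S -> nat) (g : S -> R) (K : R) :
  discrete_random_element W -> bounded_fct g ->
  uniformly_closed_space (fun f : nat -> R => bounded_fct f /\
    mean P W (fun k => f (pi k) * g k) = mean P W (fun k => f (pi k)) * K).
Proof.
move=> mW bg.
have bpi (f : nat -> R) : bounded_fct f -> bounded_fct (f \o pi) by move=> [M hM]; exists M => k; exact: hM.
split=> [a b f1 f2 [bf1 e1] [bf2 e2]|f lim].
  have bZ x (f : nat -> R) : bounded_fct f -> bounded_fct (fun k : nat => x * f k : R).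
    by move=> bf; apply: bounded_mul => //; exact: bounded_cst_fct.
  split; first by apply: bounded_add; exact: bZ.
  have bfg (f : nat -> R) : bounded_fct f -> bounded_fct (fun k => f (pi k) * g k).
    by move=> bf; apply: bounded_mul => //; exact: bpi.
  have bZg x (f : nat -> R) : bounded_fct f -> bounded_fct (fun k => x * (f (pi k) * g k)).
    by move=> bf; apply: bounded_mul; [exact: bounded_cst_fct|exact: bfg].
  under eq_fun do rewrite mulrDl -!mulrA.
  rewrite meanD ?meanZ//; try exact: bZg; try exact: bfg.
  have -> : mean P W (fun k => a * f1 (pi k) + b * f2 (pi k)) =
            a * mean P W (fun k => f1 (pi k)) + b * mean P W (fun k => f2 (pi k)).
    have m1 : mean P W (fun k => a * f1 (pi k)) = a * mean P W (fun k => f1 (pi k)).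
      by apply: meanZ => //; exact: bpi.
    have m2 : mean P W (fun k => b * f2 (pi k)) = b * mean P W (fun k => f2 (pi k)).
      by apply: meanZ => //; exact: bpi.
    by rewrite -m1 -m2; apply: meanD => //;
      [exact: (bpi (fun k => a * f1 k) (bZ _ _ bf1))|exact: (bpi (fun k => b * f2 k) (bZ _ _ bf2))].
  by rewrite e1 e2 mulrDl !mulrA.
have bf : bounded_fct f.
  have [h [[M bh] _] fh] := lim 1 ltr01; exists (1 + M) => k.
  by rewrite -(subrK (h k) (f k)) (le_trans (ler_normD _ _))// lerD.
split=> //.
have [M hM] := bg; pose L := `|M| + `|K| + 1.
have L0 : 0 < L by rewrite ltr_wpDl ?addr_ge0.
apply/eqP; rewrite -subr_eq0 -normr_eq0 eq_le normr_ge0 andbT.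
apply/ler_addgt0Pl => e e0; rewrite addr0.
have e1 : 0 < e / L by rewrite divr_gt0.
have [h [bh eh] fh] := lim _ e1.
have h1 : `|mean P W (fun k => f (pi k) * g k) - mean P W (fun k => h (pi k) * g k)| <=
    (e / L) * `|M|.
  apply: mean_dist => //; try by apply: bounded_mul => //; exact: bpi.
  move=> k; rewrite -mulrBl normrM ler_pM//.
  by rewrite (le_trans (hM k))// ler_norm.
have h2 : `|mean P W (fun k => f (pi k)) - mean P W (fun k => h (pi k))| <= e / L.
  by apply: mean_dist => //; exact: bpi.
rewrite eh in h1.
set A := mean _ _ _ in h1 *; set B := mean _ _ _ in h2 *; set B' := mean _ _ _ in h1 h2.
rewrite (_ : A - B * K = (A - B' * K) - (B - B') * K); last by ring.
rewrite (le_trans (ler_normB _ _))// (@le_trans _ _ (e / L * `|M| + e / L * `|K|))//.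
  by rewrite lerD// normrM ler_wpM2r.
rewrite -mulrDr -mulrA ler_piMr// ?ltW//.
by rewrite mulrC ltr_pdivrMr// mul1r ltrDl.
Qed.
End independent_pgf.

Section poisson.
Context d (T : measurableType d) (R : realType) (P : probability T R).

(** Uniform in the rate: at rate 0 the right-hand side is the point mass at 0
    because [0 ^+ 0 = 1]. *)
Lemma poisson_prob_set1 (a : R) (j : nat) : 0 <= a ->
  poisson_prob a 0%N [set j] = (a ^+ j / j`!%:R * expR (- a))%:E.
Proof.
rewrite le_eqVlt /poisson_prob => /orP[/eqP <-|a0].
  rewrite ltxx diracE oppr0 expR0 mulr1; congr EFin.
  case: j => [|j]; first by rewrite mem_set// expr0 fact0 divr1.
  by rewrite memNset// expr0n mul0r.
by rewrite a0 esum_set1 /poisson_pmf ?a0// lee_fin !mulr_ge0 ?expR_ge0 ?exprn_ge0 ?ltW.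
Qed.

Lemma mean_poisson_pgf (Z : T -> nat) (a s : R) :
  discrete_random_element Z -> 0 <= a -> poisson_distributed P Z a -> 0 <= s < 1 ->
  mean P Z (fun k => s ^+ k) = expR (- (a * (1 - s))).
Proof.
move=> mZ a0 pZ /andP[s0 s1].
pose f N (k : nat) : R := \sum_(j < N) s ^+ j * (k == j :> nat)%:R.
have bind (j : nat) : bounded_fct (fun k : nat => s ^+ j * (k == j)%:R).
  by apply: bounded_mul; [exact: bounded_cst_fct|exact: bounded_indic].
have bf N : bounded_fct (f N) by apply: bounded_sum => j; exact: bind.
have bs : bounded_fct (fun k : nat => s ^+ k).
  by exists 1 => k; rewrite ger0_norm ?exprn_ge0// exprn_ile1 ?(ltW s1).
have fs N k : `|f N k - s ^+ k| <= s ^+ N by rewrite geom_truncation// s0 ltW.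
have mf N : mean P Z (f N) = expR (- a) * series (exp_coeff (a * s)) N.
  rewrite mean_sum//.
  rewrite /series/= mulr_sumr big_mkord; apply: eq_bigr => j _.
  rewrite meanZ//; last exact: bounded_indic.
  rewrite mean_indic// (_ : [set k | _] = [set (j : nat)]); last first.
    by apply/seteqP; split => k /= /eqP.
  by rewrite pZ poisson_prob_set1//= /exp_coeff/= exprMn; ring.
have l1 : mean P Z (f N) @[N --> \oo] --> mean P Z (fun k => s ^+ k).
  apply/cvgrPdist_le => e e0.
  have : s ^+ n @[n --> \oo] --> 0 by apply: cvg_expr; rewrite ger0_norm.
  move=> /cvgrPdist_le/(_ _ e0); apply: filterS => M; rewrite sub0r normrN => hM.
  rewrite distrC (le_trans _ hM)// (ger0_norm (exprn_ge0 _ _))//.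
  exact: mean_dist.
have l2 : mean P Z (f N) @[N --> \oo] --> expR (- a) * expR (a * s).
  under eq_fun do rewrite mf.
  apply: cvgMr; exact: is_cvg_series_exp_coeff.
rewrite (cvg_unique _ l1 l2)// -expRD; congr expR; ring.
Qed.

(** The three indicators in the joint probability are replaced by powers one
    after the other. *)
Lemma mean_indep3 (Z1 Z2 Z3 : T -> nat) (x y z : R) :
  discrete_random_element Z1 -> discrete_random_element Z2 -> discrete_random_element Z3 ->
  (forall i j l, P (Z1 @^-1` [set i] `&` Z2 @^-1` [set j] `&` Z3 @^-1` [set l]) =
    (P (Z1 @^-1` [set i]) * P (Z2 @^-1` [set j]) * P (Z3 @^-1` [set l]))%E) ->
  0 <= x < 1 -> 0 <= y < 1 -> 0 <= z < 1 ->
  mean P (fun w => (Z1 w, Z2 w, Z3 w)) (fun k => x ^+ k.1.1 * y ^+ k.1.2 * z ^+ k.2) =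
  mean P Z1 (fun k => x ^+ k) * mean P Z2 (fun k => y ^+ k) * mean P Z3 (fun k => z ^+ k).
Proof.
move=> mZ1 mZ2 mZ3 indep x01 y01 z01.
set W := fun w => _.
have mW : discrete_random_element W by exact: discrete_pair (discrete_pair mZ1 mZ2) mZ3.
have bpow (S : Type) (pi : S -> nat) (t : R) : 0 <= t < 1 -> bounded_fct (fun k => t ^+ pi k).
  move=> /andP[t0 t1]; exists 1 => k.
  by rewrite ger0_norm ?exprn_ge0// exprn_ile1 ?(ltW t1).
pose m (Z : T -> nat) (i : nat) : R := mean P Z (fun k => (k == i)%:R).
have step0 i j l : mean P W (fun k => (k.1.1 == i)%:R * ((k.1.2 == j)%:R * (k.2 == l)%:R)) =
    m Z1 i * (m Z2 j * m Z3 l).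
  have -> : mean P W (fun k => (k.1.1 == i)%:R * ((k.1.2 == j)%:R * (k.2 == l)%:R)) =
      mean P W (fun k => [&& k.1.1 == i, k.1.2 == j & k.2 == l]%:R).
    by congr mean; apply/funext => k; rewrite -!natrM !mulnb.
  rewrite /m !mean_indic//.
  have -> : W @^-1` [set s | [&& s.1.1 == i, s.1.2 == j & s.2 == l]] =
      Z1 @^-1` [set i] `&` Z2 @^-1` [set j] `&` Z3 @^-1` [set l].
    apply/seteqP; split => w /=.
      by move=> /and3P[/eqP ? /eqP ? /eqP ?].
    by move=> [[-> ->] ->]; rewrite !eqxx.
  have E (Z : T -> nat) k : [set s | s == k] = [set k] :> set nat.
    by apply/seteqP; split => s /= /eqP.
  rewrite !E// indep -muleA !fineM// ?fin_numM//; exact: fin_num_measure.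
have step1 j l : mean P W (fun k => x ^+ k.1.1 * ((k.1.2 == j)%:R * (k.2 == l)%:R)) =
    mean P Z1 (fun k => x ^+ k) * (m Z2 j * m Z3 l).
  have bg : bounded_fct (fun k : nat * nat * nat => (k.1.2 == j)%:R * (k.2 == l)%:R : R).
    by apply: bounded_mul; exact: bounded_indic.
  have C := ucs_mean_mul P (fun k => k.1.1) (m Z2 j * m Z3 l) mW bg.
  have [_ ->//] := ucs_geom C (fun i => conj (bounded_indic R _) (step0 i j l)) x01.
have step2 l : mean P W (fun k => y ^+ k.1.2 * (x ^+ k.1.1 * (k.2 == l)%:R)) =
    mean P Z2 (fun k => y ^+ k) * (mean P Z1 (fun k => x ^+ k) * m Z3 l).
  have bg : bounded_fct (fun k : nat * nat * nat => x ^+ k.1.1 * (k.2 == l)%:R : R).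
    by apply: bounded_mul; [exact: bpow|exact: bounded_indic].
  have C := ucs_mean_mul P (fun k => k.1.2) (mean P Z1 (fun k => x ^+ k) * m Z3 l) mW bg.
  have h j : mean P W (fun k => (k.1.2 == j)%:R * (x ^+ k.1.1 * (k.2 == l)%:R)) =
      m Z2 j * (mean P Z1 (fun k => x ^+ k) * m Z3 l).
    by under eq_fun do rewrite mulrCA; rewrite step1 mulrCA.
  have [_ ->//] := ucs_geom C (fun j => conj (bounded_indic R _) (h j)) y01.
have bg : bounded_fct (fun k : nat * nat * nat => x ^+ k.1.1 * y ^+ k.1.2 : R).
  by apply: bounded_mul; exact: bpow.
have C := ucs_mean_mul P (fun k => k.2)
  (mean P Z1 (fun k => x ^+ k) * mean P Z2 (fun k => y ^+ k)) mW bg.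
have h l : mean P W (fun k => (k.2 == l)%:R * (x ^+ k.1.1 * y ^+ k.1.2)) =
    m Z3 l * (mean P Z1 (fun k => x ^+ k) * mean P Z2 (fun k => y ^+ k)).
  rewrite [RHS](_ : _ = mean P Z2 (fun k => y ^+ k) * (mean P Z1 (fun k => x ^+ k) * m Z3 l)).
    by rewrite -step2; congr mean; apply/funext => k; ring.
  by ring.
have [_ H] := ucs_geom C (fun l => conj (bounded_indic R _) (h l)) z01.
by under eq_fun do rewrite mulrC; rewrite H mulrC.
Qed.

End poisson.

Lemma mutually_independent3 d (T : measurableType d) (R : realType) (P : probability T R)
    (Z1 Z2 Z3 : T -> nat) (A B C : set nat) :
  mutually_independent P (tnth [tuple Z1; Z2; Z3]) ->
  P (Z1 @^-1` A `&` Z2 @^-1` B `&` Z3 @^-1` C) =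
  (P (Z1 @^-1` A) * P (Z2 @^-1` B) * P (Z3 @^-1` C))%E.
Proof.
move=> /(_ finset.setT (tnth [tuple A; B; C])).
under [in X in _ = X -> _]eq_bigl do rewrite inE.
rewrite !big_ord_recl big_ord0 mule1 muleA !(tnth_nth Z1) !(tnth_nth A) /= => <-.
congr (P _); apply/seteqP; split => [w [[h1 h2] h3] [i i3] _|w h].
  by case: i i3 => [|[|[|//]]] i3; rewrite !(tnth_nth Z1) !(tnth_nth A).
have h' (i : 'I_3) : (tnth [tuple Z1; Z2; Z3] i @^-1` tnth [tuple A; B; C] i) w.
  by apply: h => /=; rewrite inE.
split; first split.
- by have := h' (@Ordinal 3 0 isT); rewrite !(tnth_nth Z1) !(tnth_nth A).
- by have := h' (@Ordinal 3 1 isT); rewrite !(tnth_nth Z1) !(tnth_nth A).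
- by have := h' (@Ordinal 3 2 isT); rewrite !(tnth_nth Z1) !(tnth_nth A).
Qed.

(** * Joint law of the two layers and the colouring *)

Definition edge_pair_law (R : realType) (p p12 : R) (b : bool * bool) : R :=
  match b with
  | (true, true) => p12
  | (true, false) | (false, true) => p - p12
  | (false, false) => 1 - 2 * p + p12
  end.

Lemma sum_hypergraph_pairs (R : realType) r n (G : edge r n -> bool * bool -> R) :
  \sum_(h : hypergraph r n * hypergraph r n) \prod_e G e (e \in h.1, e \in h.2) =
  \prod_e \sum_b G e b.
Proof.
rewrite bigA_distr_bigA/=.
pose F (f : {ffun edge r n -> bool * bool}) : hypergraph r n * hypergraph r n :=
  ([set e | (f e).1]%SET, [set e | (f e).2]%SET).
pose F' (h : hypergraph r n * hypergraph r n) : {ffun edge r n -> bool * bool} :=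
  [ffun e => (e \in h.1, e \in h.2)].
rewrite (reindex F)/=; last first.
  exists F' => [f _|[h1 h2] _].
    by apply/ffunP => e; rewrite ffunE !inE -surjective_pairing.
  by congr pair; apply/setP => e; rewrite inE ffunE.
apply: eq_bigr => f _; apply: eq_bigr => e _.
by rewrite !inE -surjective_pairing.
Qed.

(** With the colouring fixed, a monochromatic edge contributes the factor
    [E (s ^ 1_H1(e) * t ^ 1_H2(e))] and any other edge the factor 1: both layers
    interact with the colouring only through one number of monochromatic edges. *)
Lemma sum_edge_pairs_pgf (R : realType) r n c (x : coloring n c) (p p12 s t : R) :
  \sum_(h : hypergraph r n * hypergraph r n)
    (\prod_e edge_pair_law p p12 (e \in h.1, e \in h.2)) *
    (s ^+ mono_count h.1 x * t ^+ mono_count h.2 x) =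
  (1 - (p12 * (1 - s * t) + (p - p12) * (1 - s) + (p - p12) * (1 - t)))
    ^+ (\sum_(e : edge r n) monochromatic x e)%N.
Proof.
pose G (e : edge r n) (b : bool * bool) : R :=
  edge_pair_law p p12 b * (s ^+ (b.1 * monochromatic x e) * t ^+ (b.2 * monochromatic x e)).
transitivity (\sum_(h : hypergraph r n * hypergraph r n) \prod_e G e (e \in h.1, e \in h.2)).
  apply: eq_bigr => h _; rewrite /G big_split/=; congr (_ * _).
  rewrite big_split/= !prodrXr; congr (_ ^+ _ * _ ^+ _); rewrite /mono_count big_mkcond/=;
  by apply: eq_bigr => e _; case: ifP; rewrite ?mul1n ?mul0n.
rewrite sum_hypergraph_pairs -prodrXr; apply: eq_bigr => e _.
rewrite (eq_bigr (fun b => G e (b.1, b.2))); last by move=> [].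
rewrite -(pair_bigA _ (fun b1 b2 => G e (b1, b2)))/= !big_bool /G /=.
by case: monochromatic => /=; rewrite ?expr0 ?expr1; ring.
Qed.

Section joint_law.
Context d (T : measurableType d) (R : realType) (P : probability T R).
Variables (r n c : nat) (p rho : R) (H1 H2 : T -> hypergraph r n) (X : T -> coloring n c).
Hypotheses (hH : correlated_ER P p rho H1 H2)
  (hX : uniform_coloring P X)
  (hHX : independent_pair P (fun w => (H1 w, H2 w)) X).

Let p12 := rho + p ^+ 2.

Lemma measurable_edges (A : set (bool * bool)) (e : edge r n) :
  measurable [set w | A (e \in H1 w, e \in H2 w)].
Proof. exact: (cER_random hH [set h : hypergraph r n * hypergraph r n | A (e \in h.1, e \in h.2)]). Qed.

Lemma edge_pair_prob (e : edge r n) (b : bool * bool) :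
  P [set w | (e \in H1 w, e \in H2 w) = b] = (edge_pair_law p p12 b)%:E.
Proof.
pose A b : set T := [set w | (e \in H1 w, e \in H2 w) = b].
have mA b' : measurable (A b') by exact: (measurable_edges [set b'] e).
have P11 : P (A (true, true)) = p12%:E.
  rewrite -(cER_edge12 hH e); congr (P _).
  by apply/seteqP; split => w; rewrite /A /=; [move=> [-> ->]|move=> [-> ->]].
have fin b' : P (A b') \is a fin_num by exact: fin_num_measure.
have PU b1 b2 : b1 != b2 -> P (A b1 `|` A b2) = (P (A b1) + P (A b2))%E.
  move=> b12; rewrite measureU//; apply/seteqP; split => // w [/= h1 h2].
  by move: b12; rewrite -h1 -h2 eqxx.
have P10 : P (A (true, false)) = (p - p12)%:E.
  have := PU (true, true) (true, false) isT.
  have -> : A (true, true) `|` A (true, false) = [set w | e \in H1 w].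
    apply/seteqP; split => w; rewrite /A /=; first by case=> [[->]|[->]].
    by move=> ->; case: (e \in H2 w); [left|right].
  rewrite (cER_edge1 hH) P11 -(fineK (fin (true, false))) -EFinD => -[->].
  by congr EFin; rewrite addrAC subrr add0r.
have P01 : P (A (false, true)) = (p - p12)%:E.
  have := PU (true, true) (false, true) isT.
  have -> : A (true, true) `|` A (false, true) = [set w | e \in H2 w].
    apply/seteqP; split => w; rewrite /A /=; first by case=> [[_ ->]|[_ ->]].
    by move=> ->; case: (e \in H1 w); [left|right].
  rewrite (cER_edge2 hH) P11 -(fineK (fin (false, true))) -EFinD => -[->].
  by congr EFin; rewrite addrAC subrr add0r.
case: b => [[] []] //=.
have mH1 : measurable [set w | e \in H1 w].
  exact: (measurable_edges [set b : bool * bool | b.1] e).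
have : P (A (false, true) `|` A (false, false)) = (1 - p)%:E.
  rewrite EFinB -(cER_edge1 hH e) -probability_setC//; congr (P _).
  apply/seteqP; split => w; rewrite /A /=; first by case=> [[-> _]|[-> _]].
  by move=> /negP/negbTE ->; case: (e \in H2 w); [left|right].
rewrite PU// P01 -/(A (false, false)) -(fineK (fin (false, false))) -EFinD => -[h].
by congr EFin; lra.
Qed.

Lemma hypergraph_pair_prob (h : hypergraph r n * hypergraph r n) :
  P [set w | (H1 w, H2 w) = h] =
  (\prod_e edge_pair_law p p12 (e \in h.1, e \in h.2))%:E.
Proof.
have := cER_indep hH finset.setT (fun e => [set (e \in h.1, e \in h.2)]).
rewrite -prodEFin; under [in X in _ = X -> _]eq_bigl do rewrite inE.
under [in X in _ = X -> _]eq_bigr do rewrite /= edge_pair_prob.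
move=> <-; congr (P _); apply/seteqP; split => w /=.
  by move=> <- e _.
move=> hw; rewrite [h]surjective_pairing.
have {}hw e : (e \in H1 w, e \in H2 w) = (e \in h.1, e \in h.2).
  by apply: hw; rewrite /= inE.
by congr pair; apply/setP => e; case: (hw e).
Qed.

Lemma coloring_prob (x : coloring n c) : P [set w | X w = x] = ((c%:R ^+ n)^-1)%:E.
Proof.
have := ucol_indep hX finset.setT (fun v => [set x v]).
under [in X in _ = X -> _]eq_bigl do rewrite inE.
under [in X in _ = X -> _]eq_bigr do rewrite /= (ucol_unif hX).
rewrite prodEFin prodr_const cardT size_enum_ord exprVn => <-.
congr (P _); apply/seteqP; split => w /=; first by move=> <- v _.
by move=> hw; apply/ffunP => v; apply: hw; rewrite /= inE.
Qed.

Lemma discrete_joint : discrete_random_element (fun w => ((H1 w, H2 w), X w)).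
Proof. exact: discrete_pair (cER_random hH) (ucol_random hX). Qed.

Lemma mono_counts_pgf (s t : R) :
  mean P (fun w => (mono_count (H1 w) (X w), mono_count (H2 w) (X w)))
    (fun k => s ^+ k.1 * t ^+ k.2) =
  avg (fun x : coloring n c =>
    (1 - (p12 * (1 - s * t) + (p - p12) * (1 - s) + (p - p12) * (1 - t)))
      ^+ (\sum_(e : edge r n) monochromatic x e)%N).
Proof.
transitivity (mean P (fun w => ((H1 w, H2 w), X w))
  (fun z => s ^+ mono_count z.1.1 z.2 * t ^+ mono_count z.1.2 z.2)) => //.
rewrite mean_finite; last exact: discrete_joint.
rewrite /avg mulr_sumr.
under [RHS]eq_bigr do rewrite -sum_edge_pairs_pgf mulr_sumr.
rewrite exchange_big pair_bigA/=; apply: eq_bigr => -[h x] _ /=.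
have -> : (fun w => (H1 w, H2 w, X w)) @^-1` [set (h, x)] =
    [set w | (H1 w, H2 w) = h] `&` [set w | X w = x].
  by apply/seteqP; split => w /=; [move=> [<- <-]|move=> [<- <-]].
have := hHX [set h] [set x]; rewrite /preimage /= => ->.
rewrite hypergraph_pair_prob coloring_prob -EFinM /= [LHS]mulrA [LHS]mulrC.
by congr (_ * _); exact: mulrC.
Qed.

End joint_law.

(** * Expected counts *)

Section joint_expectations.
Context d (T : measurableType d) (R : realType) (P : probability T R).
Variables (r n c : nat) (p rho : R) (H1 H2 : T -> hypergraph r n) (X : T -> coloring n c).
Hypotheses (r0 : (0 < r)%N) (c0 : (0 < c)%N) (hH : correlated_ER P p rho H1 H2)
  (hX : uniform_coloring P X)
  (hHX : independent_pair P (fun w => (H1 w, H2 w)) X).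

Lemma monochromatic_prob (e : edge r n) :
  P [set w | monochromatic (X w) e] = ((c%:R ^+ (r - 1))^-1)%:E.
Proof.
have mX := ucol_random hX.
have fP : P [set w | monochromatic (X w) e] \is a fin_num.
  exact: fin_num_measure (mX [set x | monochromatic x e]).
rewrite -(fineK fP); congr EFin.
rewrite -[fine _](mean_indic P mX (fun x => monochromatic x e)) mean_finite//.
have [v ve] : exists v, v \in val e by apply/set0Pn; rewrite -card_gt0 edge_card.
rewrite subn1 -[in RHS](edge_card e) -(avg_mono R c0 ve) /avg mulr_sumr.
apply: eq_bigr => x _.
have := coloring_prob hX x; rewrite /preimage /= => ->.
by rewrite mulrC.
Qed.

Lemma mean_mono_edges (b : bool * bool -> bool) (q : R) :
  (forall e : edge r n, P [set w | b (e \in H1 w, e \in H2 w)] = q%:E) ->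
  mean P (fun w => ((H1 w, H2 w), X w))
    (fun z => \sum_(e : edge r n) (b (e \in z.1.1, e \in z.1.2) && monochromatic z.2 e)%:R)
  = 'C(n, r)%:R * q / c%:R ^+ (r - 1).
Proof.
move=> hb; have mW := discrete_joint hH hX.
rewrite mean_sum//; last by move=> e; exact: bounded_indic.
rewrite (eq_bigr (fun=> q / c%:R ^+ (r - 1))); last first.
  move=> e _; rewrite mean_indic//.
  have -> : (fun w => (H1 w, H2 w, X w)) @^-1`
      [set z : hypergraph r n * hypergraph r n * coloring n c | b (e \in z.1.1, e \in z.1.2) && monochromatic z.2 e] =
      [set w | b (e \in H1 w, e \in H2 w)] `&` [set w | monochromatic (X w) e].
    by apply/seteqP; split => w /= => [/andP[]//|[-> ->]].
  have := hHX [set h : hypergraph r n * hypergraph r n | b (e \in h.1, e \in h.2)] [set x | monochromatic x e].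
  by rewrite /preimage /= => ->; rewrite hb monochromatic_prob -EFinM.
by rewrite sumr_const card_edge -[LHS]mulr_natl mulrA.
Qed.

Lemma bounded_finite (S : finType) (phi : S -> R) : bounded_fct phi.
Proof. by exists (\sum_s `|phi s|) => s; rewrite (bigD1 s)//= lerDl sumr_ge0. Qed.

Lemma expectation_mono_count1 :
  ('E_P[fun w => (mono_count (H1 w) (X w))%:R])%E =
  ('C(n, r)%:R * p / c%:R ^+ (r - 1))%:E.
Proof.
rewrite -(mean_mono_edges (b := fst) (cER_edge1 hH)).
rewrite -(expectation_mean P (discrete_joint hH hX)); last exact: bounded_finite.
congr expectation; apply/funext => w /=; rewrite /mono_count natr_sum big_mkcond/=.
by apply: eq_bigr => e _; case: ifP.
Qed.

Lemma expectation_mono_count2 :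
  ('E_P[fun w => (mono_count (H2 w) (X w))%:R])%E =
  ('C(n, r)%:R * p / c%:R ^+ (r - 1))%:E.
Proof.
rewrite -(mean_mono_edges (b := snd) (cER_edge2 hH)).
rewrite -(expectation_mean P (discrete_joint hH hX)); last exact: bounded_finite.
congr expectation; apply/funext => w /=; rewrite /mono_count natr_sum big_mkcond/=.
by apply: eq_bigr => e _; case: ifP.
Qed.

Lemma expectation_common_edges :
  ('E_P[fun w => (#|H1 w :&: H2 w|%:R / c%:R ^+ (r - 1))%R])%E =
  ('C(n, r)%:R * (rho + p ^+ 2) / c%:R ^+ (r - 1))%:E.
Proof.
have mW := cER_random hH.
pose phi (h : hypergraph r n * hypergraph r n) : R :=
  #|h.1 :&: h.2|%:R / c%:R ^+ (r - 1).
rewrite (_ : (fun w => _) = phi \o (fun w => (H1 w, H2 w)))//.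
rewrite (expectation_mean P mW); last exact: bounded_finite.
congr EFin; rewrite (_ : phi = fun h => \sum_(e : edge r n)
    (c%:R ^+ (r - 1))^-1 * ((e \in h.1) && (e \in h.2))%:R); last first.
  apply/funext => h; rewrite /phi -mulr_sumr mulrC; congr (_ * _).
  by rewrite -sum1_card natr_sum big_mkcond/=; apply: eq_bigr => e _; rewrite inE; case: andP.
rewrite mean_sum//; last by move=> e; exact: bounded_finite.
rewrite (eq_bigr (fun=> (c%:R ^+ (r - 1))^-1 * (rho + p ^+ 2))); last first.
  move=> e _; rewrite meanZ//; last exact: bounded_finite.
  rewrite mean_indic//; congr (_ * _).
  rewrite (_ : _ @^-1` _ = [set w | e \in H1 w /\ e \in H2 w]).
    by rewrite (cER_edge12 hH).
  by apply/seteqP; split => w /= /andP.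
by rewrite sumr_const card_edge -[LHS]mulr_natl [(_ ^-1 * _)]mulrC mulrA.
Qed.

End joint_expectations.

(** * Asymptotics of the error bound *)

(** Each of the [r] factors of the falling factorial is at least [n / 2]. *)
Lemma expn_le_bin n r : (r.*2 <= n)%N -> (n ^ r <= 2 ^ r * r`! * 'C(n, r))%N.
Proof.
move=> rn; rewrite -mulnA [(_`! * _)%N]mulnC bin_ffact.
have H m : (m <= r)%N -> (n ^ m <= 2 ^ m * n ^_ m)%N.
  elim: m => // m IH mr; rewrite ffactnSr !expnSr mulnACA leq_mul ?IH ?(ltnW mr)//.
  have mn : (m.*2 <= n)%N by apply: leq_trans rn; rewrite leq_double ltnW.
  by rewrite mul2n doubleB -addnn -addnBA// leq_addr.
exact: H.
Qed.

(** Intermediate powers cost an arbitrarily small constant plus a multiple of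
    the [r]-th power, the only one that the assumptions control. *)
Lemma expr_le_split (R : realFieldType) (x de : R) (m r : nat) :
  0 <= x -> 0 < de <= 1 -> (0 < m <= r)%N -> x ^+ m <= de + de ^- r * x ^+ r.
Proof.
move=> x0 /andP[d0 d1] /andP[m0 mr].
have dr : 0 < de ^- r by rewrite invr_gt0 exprn_gt0.
have [xd|dx] := leP x de.
  rewrite (@le_trans _ _ de)//; last by rewrite lerDl mulr_ge0 ?exprn_ge0// ltW.
  rewrite -(prednK m0) exprS; apply: (le_trans _ xd).
  by rewrite ler_piMr// exprn_ile1//; exact: le_trans xd d1.
rewrite -[leLHS]add0r lerD ?(ltW d0)//.
rewrite mulrC ler_pdivlMr ?exprn_gt0// -(subnKC mr) !exprD.
rewrite ler_wpM2l ?exprn_ge0// -[leRHS]mul1r ler_pM ?exprn_ge0 ?(ltW d0)//.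
  by rewrite exprn_ile1 ?(ltW d0).
by rewrite lerXn2r ?nnegrE ?(ltW d0) ?(ltW dx).
Qed.

Section asymptotics.
Variables (R : realType) (r : nat) (c : nat -> nat).
Hypotheses (r2 : (2 <= r)%N) (c0 : forall n, (0 < c n)%N).

Let Lam n : R := 'C(n, r)%:R / (c n)%:R ^+ (r - 1).

Let cp n : 0 < (c n)%:R :> R. Proof. by rewrite ltr0n. Qed.

(** [c ^ (r - 1)] is [C(n, r) * p], which tends to infinity with [n ^ r * p],
    divided by a bounded quantity. *)
Lemma colors_cvg_pinfty (p : nat -> R) (lambda : R) :
  (forall n, 0 < p n) ->
  'C(n, r)%:R * p n / (c n)%:R ^+ (r - 1) @[n --> \oo] --> lambda ->
  p n * n%:R ^+ r @[n --> \oo] --> +oo ->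
  (c n)%:R @[n --> \oo] --> (+oo : set_system R).
Proof.
move=> p0 hcvg hpn; apply/cvgryPge => A.
pose A1 := `|A| + 1; pose l1 := `|lambda| + 1.
have A10 : 0 < A1 by rewrite ltr_wpDl.
have l10 : 0 < l1 by rewrite ltr_wpDl.
pose K : R := (2 ^ r * r`!)%:R.
have K0 : 0 < K by rewrite ltr0n muln_gt0 expn_gt0 fact_gt0.
have /cvgrPdist_le/(_ _ ltr01) near1 := hcvg.
have /cvgryPgt/(_ (K * (l1 * A1 ^+ (r - 1)))) near2 := hpn.
have near3 := nbhs_infty_ge r.*2.
near=> n.
have h1 : `|lambda - 'C(n, r)%:R * p n / (c n)%:R ^+ (r - 1)| <= 1 by near: n.
have h2 : K * (l1 * A1 ^+ (r - 1)) < p n * n%:R ^+ r by near: n.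
have h3 : (r.*2 <= n)%N by near: n.
rewrite leNgt; apply/negP => cA.
have cA1 : (c n)%:R <= A1 by rewrite ltW// (lt_le_trans cA)// ler_wpDr// ler_norm.
have : p n * n%:R ^+ r <= K * (l1 * A1 ^+ (r - 1)).
  apply: (@le_trans _ _ (K * ('C(n, r)%:R * p n))).
    rewrite mulrA mulrC ler_wpM2r ?(ltW (p0 n))//.
    by rewrite -natrX -natrM ler_nat expn_le_bin.
  rewrite ler_wpM2l ?(ltW K0)//.
  rewrite -[leLHS](@divfK _ ((c n)%:R ^+ (r - 1))); last by rewrite expf_neq0// gt_eqF.
  have C0 : 0 <= 'C(n, r)%:R * p n / (c n)%:R ^+ (r - 1).
    by rewrite divr_ge0 ?mulr_ge0 ?exprn_ge0 ?(ltW (p0 n)).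
  rewrite ler_pM ?exprn_ge0//.
    move: h1; rewrite ler_distlC => /andP[_ h]; apply: le_trans h _.
    by rewrite /l1 lerD// ler_norm.
  by rewrite lerXn2r ?nnegrE ?(ltW A10).
by rewrite leNgt h2.
Unshelve. all: by end_near. Qed.

(** The quantity [th * (n / c) ^ r] is of the order of [th * Lam / c], hence
    tends to 0; by [expr_le_split] so does [th * (n / c) ^ m] for [0 < m < r].  The
    rest of the error is made of bounded factors [th * Lam]. *)
Lemma stein_chen_error_cvg0 (th : nat -> R) (mu : R) :
  (forall n, 0 <= th n <= 1) -> (c n)%:R @[n --> \oo] --> (+oo : set_system R) ->
  th n * Lam n @[n --> \oo] --> mu ->
  th n ^+ 2 * (Lam n * (2 * (2 ^+ r * \sum_(m < r | (0 < m)%N) (n%:R / (c n)%:R) ^+ m)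
     + ((c n)%:R ^+ (r - 1))^-1)) @[n --> \oo] --> (0 : R).
Proof.
move=> th01 cinf hmu; apply/cvgrPdist_le => e e0.
pose m1 := `|mu| + 1; have m10 : 0 < m1 by rewrite ltr_wpDl.
pose C0 : R := 2 * (2 ^+ r * r%:R).
have C00 : 0 < C0 by rewrite !mulr_gt0 ?exprn_gt0// ltr0n (leq_trans _ r2).
pose K : R := (2 ^ r * r`!)%:R.
have K0 : 0 < K by rewrite ltr0n muln_gt0 expn_gt0 fact_gt0.
(* [de] is chosen so that the constant part of [expr_le_split] contributes at
   most [e / 2]. *)
pose de := Num.min 1 (e / (2 * (m1 * C0))).
have mC0 : 0 < m1 * C0 by exact: mulr_gt0.
have de0 : 0 < de by rewrite lt_min ltr01 divr_gt0// mulr_gt0.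
have de1 : de <= 1 by rewrite ge_min lexx.
have hde : m1 * (C0 * de) <= e / 2.
  have : de <= e / (2 * (m1 * C0)) by rewrite ge_min lexx orbT.
  by rewrite ler_pdivlMr ?(mulr_gt0 _ mC0)//; lra.
pose B := m1 * (C0 * (de ^- r * (K * m1)) + 1).
have B0 : 0 < B.
  by rewrite mulr_gt0// ltr_wpDl// !mulr_ge0 ?(ltW C00) ?(ltW K0) ?(ltW m10)// invr_ge0 exprn_ge0 ?(ltW de0).
have /cvgrPdist_le/(_ _ ltr01) near1 := hmu.
have /cvgryPge/(_ (2 * B / e)) near2 := cinf.
have near3 := nbhs_infty_ge r.*2.
near=> n.
have h1 : `|mu - th n * Lam n| <= 1 by near: n.
have h2 : 2 * B / e <= (c n)%:R by near: n.
have h3 : (r.*2 <= n)%N by near: n.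
have /andP[t0 t1] := th01 n.
have L0 : 0 <= Lam n by rewrite divr_ge0 ?exprn_ge0.
have c1 : 1 <= (c n)%:R :> R by rewrite ler1n.
set x : R := n%:R / (c n)%:R.
have x0 : 0 <= x by rewrite divr_ge0.
set S := \sum_(m < r | _) _.
have S0 : 0 <= S by apply: sumr_ge0 => m _; rewrite exprn_ge0.
set q := ((c n)%:R ^+ (r - 1))^-1.
have q0 : 0 <= q by rewrite invr_ge0 exprn_ge0.
have qc : q <= (c n)%:R^-1.
  rewrite /q -exprVn -[leRHS]expr1 ler_wiXn2l ?invf_le1 ?invr_ge0//.
  by rewrite subn_gt0.
have thL : th n * Lam n <= m1.
  move: h1; rewrite ler_distlC => /andP[_ h]; apply: le_trans h _.
  by rewrite /m1 lerD// ler_norm.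
have hS : S <= r%:R * (de + de ^- r * x ^+ r).
  apply: (@le_trans _ _ (\sum_(m < r) (de + de ^- r * x ^+ r))).
    rewrite /S big_mkcond/=; apply: ler_sum => m _; case: ifPn => m0.
      by apply: expr_le_split; rewrite ?de0 ?m0//= ltnW.
    by rewrite addr_ge0 ?(ltW de0)// mulr_ge0 ?invr_ge0 ?exprn_ge0 ?(ltW de0).
  by rewrite sumr_const card_ord mulr_natl.
(* one factor of theta pays for the r-th power of n / c *)
have hx : th n * x ^+ r <= K * m1 / (c n)%:R.
  have -> : th n * x ^+ r = th n * n%:R ^+ r / (c n)%:R ^+ (r - 1) / (c n)%:R.
    rewrite /x expr_div_n -(mulrA _ _ (_ ^-1)) -invfM -exprSr subn1 prednK ?mulrA//.
    exact: leq_trans r2.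
  rewrite ler_wpM2r ?invr_ge0//.
  apply: (@le_trans _ _ (K * (th n * Lam n))); last by rewrite ler_wpM2l ?(ltW K0).
  have nK : n%:R ^+ r <= K * 'C(n, r)%:R.
    by rewrite -natrX -natrM ler_nat expn_le_bin.
  rewrite (_ : K * _ = th n * (K * 'C(n, r)%:R) * q); last by rewrite /Lam /q; ring.
  by rewrite ler_wpM2r// ler_wpM2l.
rewrite sub0r normrN ger0_norm; last first.
  by rewrite mulr_ge0 ?exprn_ge0// mulr_ge0// addr_ge0// !mulr_ge0// exprn_ge0.
have -> : th n ^+ 2 * (Lam n * (2 * (2 ^+ r * S) + q)) =
   (th n * Lam n) * (2 * (2 ^+ r * (th n * S)) + th n * q) by ring.
have tS : th n * S <= r%:R * (de + de ^- r * (K * m1 / (c n)%:R)).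
  apply: (@le_trans _ _ (th n * (r%:R * (de + de ^- r * x ^+ r)))).
    by rewrite ler_wpM2l.
  rewrite mulrCA ler_wpM2l// mulrDr mulrCA lerD//.
    by rewrite ler_piMl ?(ltW de0).
  by rewrite ler_wpM2l// invr_ge0 exprn_ge0 ?(ltW de0).
have tq : th n * q <= (c n)%:R^-1.
  by apply: le_trans qc; rewrite ler_piMl.
apply: (@le_trans _ _ (m1 * (C0 * (de + de ^- r * (K * m1 / (c n)%:R)) + (c n)%:R^-1))).
  rewrite ler_pM ?mulr_ge0// ?addr_ge0 ?mulr_ge0 ?exprn_ge0//.
  move: tS; set Y := de + _ => tS.
  by rewrite lerD// /C0 -!mulrA !ler_wpM2l ?exprn_ge0.
rewrite (_ : _ * _ = m1 * (C0 * de) + B / (c n)%:R); last by rewrite /B; ring.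
rewrite [leRHS](splitr e) lerD//.
rewrite ler_pdivrMr//.
by move: h2; rewrite ler_pdivrMr//; lra.
Unshelve. all: by end_near. Qed.

End asymptotics.

(** * Convergence of the two counts *)

Section joint_limit.
Context (R : realType) (r : nat) (p rho : nat -> R) (c : nat -> nat) (lambda lambda12 : R).
Hypotheses (r2 : (2 <= r)%N) (c0 : forall n, (0 < c n)%N)
  (hp : forall n, 0 < p n < 1) (hrho : forall n, 0 <= rho n < p n * (1 - p n))
  (hcvg : (fun n => 'C(n, r)%:R * p n / (c n)%:R ^+ (r - 1)) @ \oo --> lambda)
  (hcvg12 : (fun n => 'C(n, r)%:R * (rho n + p n ^+ 2) / (c n)%:R ^+ (r - 1))
    @ \oo --> lambda12)
  (hpn : (fun n => p n * n%:R ^+ r) @ \oo --> +oo).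

(** The quantity subtracted from 1 is the probability that some membership of a
    given [r]-set is lost when the edges of the two layers are kept independently
    with probabilities [s] and [t].  Multiplied by the mean number of monochromatic
    [r]-sets it converges to minus the exponent of the limit. *)
Lemma avg_pgf_cvg (s t : R) : 0 <= s < 1 -> 0 <= t < 1 ->
  avg (fun x : coloring n (c n) =>
    (1 - ((rho n + p n ^+ 2) * (1 - s * t) + (p n - (rho n + p n ^+ 2)) * (1 - s)
          + (p n - (rho n + p n ^+ 2)) * (1 - t)))
      ^+ (\sum_(e : edge r n) monochromatic x e)%N) @[n --> \oo] -->
  expR (- ((lambda - lambda12) * (1 - s))) * expR (- ((lambda - lambda12) * (1 - t)))
    * expR (- (lambda12 * (1 - s * t))).
Proof.
move=> /andP[s0 s1] /andP[t0 t1].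
pose th n := (rho n + p n ^+ 2) * (1 - s * t) + (p n - (rho n + p n ^+ 2)) * (1 - s)
          + (p n - (rho n + p n ^+ 2)) * (1 - t).
pose mu := (lambda - lambda12) * (1 - s) + (lambda - lambda12) * (1 - t)
  + lambda12 * (1 - s * t).
have st0 : 0 <= s * t by exact: mulr_ge0.
have st1 : s * t <= 1 by rewrite mulr_ile1// ltW.
have th01 n : 0 <= th n <= 1.
  have /andP[p0 p1] := hp n; have /andP[rho0 rho1] := hrho n.
  have q0 : 0 <= rho n + p n ^+ 2 by rewrite addr_ge0// exprn_ge0// ltW.
  have q1 : 0 <= p n - (rho n + p n ^+ 2) by nra.
  have q2 : 0 <= (1 - p n) ^+ 2 by rewrite sqr_ge0.
  rewrite /th; set a := rho n + _ in q0 q1 *; set b := p n - a in q1 *.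
  have a1 : a * (1 - s * t) <= a by rewrite ler_piMr//; lra.
  have b1 : b * (1 - s) <= b by rewrite ler_piMr//; lra.
  have b2 : b * (1 - t) <= b by rewrite ler_piMr//; lra.
  have ab : a + b + b <= 1 by rewrite /b /a; nra.
  apply/andP; split; last lra.
  by rewrite !addr_ge0// mulr_ge0//; lra.
have thL : th n * ('C(n, r)%:R / (c n)%:R ^+ (r - 1)) @[n --> \oo] --> mu.
  have -> : (fun n => th n * ('C(n, r)%:R / (c n)%:R ^+ (r - 1))) =
    (fun n => ('C(n, r)%:R * p n / (c n)%:R ^+ (r - 1) -
               'C(n, r)%:R * (rho n + p n ^+ 2) / (c n)%:R ^+ (r - 1)) * (1 - s)
            + ('C(n, r)%:R * p n / (c n)%:R ^+ (r - 1) -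
               'C(n, r)%:R * (rho n + p n ^+ 2) / (c n)%:R ^+ (r - 1)) * (1 - t)
            + 'C(n, r)%:R * (rho n + p n ^+ 2) / (c n)%:R ^+ (r - 1) * (1 - s * t)).
    by apply/funext => n; rewrite /th; ring.
  by apply: cvgD; [apply: cvgD|]; apply: cvgMl => //; exact: cvgB.
have cinf : (c n)%:R @[n --> \oo] --> (+oo : set_system R).
  by apply: colors_cvg_pinfty hcvg hpn => // n; case/andP: (hp n).
have err := stein_chen_error_cvg0 r2 c0 th01 cinf thL.
have lim_exp : expR (- (th n * ('C(n, r)%:R / (c n)%:R ^+ (r - 1)))) @[n --> \oo] -->
    expR (- mu).
  by apply: continuous_cvg; [exact: continuous_expR|exact: cvgN].
rewrite -!expRD [X in expR X](_ : _ = - mu); last by rewrite /mu; ring.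
apply/cvgrPdist_le => e e0.
have e2 : 0 < e / 2 by rewrite divr_gt0.
have /cvgrPdist_le/(_ _ e2) near1 := err.
have /cvgrPdist_le/(_ _ e2) near2 := lim_exp.
near=> n.
have h := mono_count_pgf n r2 (c0 n) (th01 n).
have h1 : `|expR (- mu) - expR (- (th n * ('C(n, r)%:R / (c n)%:R ^+ (r - 1))))| <= e / 2.
  by near: n.
have h2 : `|0 - th n ^+ 2 * ('C(n, r)%:R / (c n)%:R ^+ (r - 1) *
    (2 * (2 ^+ r * \sum_(m < r | (0 < m)%N) (n%:R / (c n)%:R) ^+ m)
     + ((c n)%:R ^+ (r - 1))^-1))| <= e / 2 by near: n.
rewrite sub0r normrN in h2.
have {}h := le_trans h (le_trans (ler_norm _) h2).
rewrite distrC in h.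
rewrite [leRHS](splitr e) (le_trans _ (lerD h1 h))//.
by rewrite (le_trans _ (ler_normD _ _))// addrA subrK.
Unshelve. all: by end_near. Qed.

End joint_limit.

(** In [s ^ (Z1 + Z12) * t ^ (Z2 + Z12)] the shared variable [Z12] is weighted
    by [s * t], as an edge of both layers is in [sum_edge_pairs_pgf]. *)
Lemma poisson_sums_pgf d (T : measurableType d) (R : realType) (P : probability T R)
    (Z1 Z2 Z12 : T -> nat) (a a12 s t : R) :
  discrete_random_element Z1 -> discrete_random_element Z2 ->
  discrete_random_element Z12 ->
  mutually_independent P (tnth [tuple Z1; Z2; Z12]) -> 0 <= a -> 0 <= a12 ->
  poisson_distributed P Z1 a -> poisson_distributed P Z2 a ->
  poisson_distributed P Z12 a12 -> 0 <= s < 1 -> 0 <= t < 1 ->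
  mean P (fun w => (Z1 w + Z12 w, Z2 w + Z12 w)%N) (fun k => s ^+ k.1 * t ^+ k.2) =
  expR (- (a * (1 - s))) * expR (- (a * (1 - t))) * expR (- (a12 * (1 - s * t))).
Proof.
move=> mZ1 mZ2 mZ12 indep a0 a120 pZ1 pZ2 pZ12 s01 t01.
have st01 : 0 <= s * t < 1.
  case/andP: s01 => s0 s1; case/andP: t01 => t0 t1.
  by rewrite mulr_ge0//= (le_lt_trans _ s1)// ler_piMr// ltW.
transitivity (mean P (fun w => (Z1 w, Z2 w, Z12 w))
    (fun k => s ^+ k.1.1 * t ^+ k.1.2 * (s * t) ^+ k.2)).
  rewrite /mean; congr (fine _); apply: eq_integral => w _ /=; congr EFin.
  by rewrite !exprD exprMn mulrACA.
rewrite mean_indep3//; last by move=> *; exact: mutually_independent3 indep.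
by rewrite (mean_poisson_pgf mZ1 a0 pZ1 s01) (mean_poisson_pgf mZ2 a0 pZ2 t01)
  (mean_poisson_pgf mZ12 a120 pZ12 st01).
Qed.

Theorem mainTheorem9 (R : realType) (r : nat) (hr : (2 <= r)%N)
  (p rho : nat -> R) (c : nat -> nat) (lambda lambda12 : R)
  (hp : forall n, 0 < p n < 1)
  (hrho : forall n, 0 <= rho n < p n * (1 - p n))
  (hc : forall n, (0 < c n)%N)
  (hlambda : 0 <= lambda12 < lambda)
  (d : nat -> measure_display) (T : forall n, measurableType (d n))
  (P : forall n, probability (T n) R)
  (H1 H2 : forall n, T n -> hypergraph r n)
  (X : forall n, T n -> coloring n (c n))
  (hH : forall n, correlated_ER (P n) (p n) (rho n) (H1 n) (H2 n))
  (hX : forall n, uniform_coloring (P n) (X n))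
  (hHX : forall n,
    independent_pair (P n) (fun w => (H1 n w, H2 n w)) (X n))
  (hcvg : (fun n => 'C(n, r)%:R * p n / (c n)%:R ^+ (r - 1)) @ \oo --> lambda)
  (hcvg12 : (fun n => 'C(n, r)%:R * (rho n + p n ^+ 2) / (c n)%:R ^+ (r - 1))
    @ \oo --> lambda12)
  (hpn : (fun n => p n * n%:R ^+ r) @ \oo --> +oo)
  (d' : measure_display) (T' : measurableType d') (P' : probability T' R)
  (Z1 Z2 Z12 : {RV P' >-> nat})
  (hZ : mutually_independent P'
    (tnth [tuple (Z1 : T' -> nat); (Z2 : T' -> nat); (Z12 : T' -> nat)]))
  (hZ1 : poisson_distributed P' Z1 (lambda - lambda12))
  (hZ2 : poisson_distributed P' Z2 (lambda - lambda12))
  (hZ12 : poisson_distributed P' Z12 lambda12) :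
  (forall n,
    [/\ ('E_(P n)[fun w => (mono_count (H1 n w) (X n w))%:R])%E =
          ('C(n, r)%:R * p n / (c n)%:R ^+ (r - 1))%:E,
        ('E_(P n)[fun w => (mono_count (H2 n w) (X n w))%:R])%E =
          ('C(n, r)%:R * p n / (c n)%:R ^+ (r - 1))%:E &
        ('E_(P n)[fun w => (#|H1 n w :&: H2 n w|%:R / (c n)%:R ^+ (r - 1))%R])%E
          = ('C(n, r)%:R * (rho n + p n ^+ 2) / (c n)%:R ^+ (r - 1))%:E]) /\
  cvg_in_distribution P
    (fun n w => ((mono_count (H1 n w) (X n w))%:R : R,
                 (mono_count (H2 n w) (X n w))%:R : R))
    P'
    (fun w => ((Z1 w + Z12 w)%:R : R, (Z2 w + Z12 w)%:R : R)).
Proof.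
split.
  have r0 : (0 < r)%N by exact: leq_trans hr.
  move=> n; split.
  - exact: expectation_mono_count1 r0 (hc n) (hH n) (hX n) (hHX n).
  - exact: expectation_mono_count2 r0 (hc n) (hH n) (hX n) (hHX n).
  - exact: expectation_common_edges (hH n).
move=> f _ [M fM].
pose Y n (w : T n) := (mono_count (H1 n w) (X n w), mono_count (H2 n w) (X n w)).
pose Y' w := (Z1 w + Z12 w, Z2 w + Z12 w)%N.
pose phi (k : nat * nat) : R := f (k.1%:R, k.2%:R).
have bphi : bounded_fct phi by exists M => k; exact: fM.
have mZ (Z : {RV P' >-> nat}) : discrete_random_element Z.
  by move=> A; rewrite -[_ @^-1` _]setTI; exact: measurable_funP.
have mY n : discrete_random_element (@Y n).
  move=> A; exact: (discrete_joint (hH n) (hX n)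
    [set z | A (mono_count z.1.1 z.2, mono_count z.1.2 z.2)]).
have mY' : discrete_random_element Y'.
  move=> A; exact: (discrete_pair (discrete_pair (mZ Z1) (mZ Z2)) (mZ Z12)
    [set z | A (z.1.1 + z.2, z.1.2 + z.2)%N]).
have := expectation_mean P' mY' bphi; rewrite /comp => ->.
have E n := expectation_mean (P n) (mY n) bphi.
under eq_fun => n do rewrite (E n : 'E_(P n)[_ \o _]%E = _).
apply: cvg_EFin; first exact: nearW.
apply: (cvg_mean_of_cvg_pgf mY mY') bphi => s t s01 t01.
have /andP[l0 l1] := hlambda.
rewrite (@poisson_sums_pgf _ _ _ P' Z1 Z2 Z12 (lambda - lambda12) lambda12)//;
  try exact: mZ; last by rewrite subr_ge0 ltW.
under eq_fun => n do rewrite (mono_counts_pgf (hH n) (hX n) (hHX n)).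
exact: avg_pgf_cvg.
Qed.
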